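(* Assume (K1) and let $\lambda\in\mathbb{R}\setminus\Sigma$. Let $f,u\in L^1(\Omega;\delta^\gamma)$. Then the following are equivalent: (1) $u=\mathbb{G}_\lambda(f)$ a.e. in $\Omega$; (2) $\int_\Omega u\psi\,dx=\int_\Omega f\,\mathbb{G}_\lambda(\psi)\,dx$ for all $\psi\in\delta^\gamma L^\infty(\Omega)$; (3) $\int_\Omega u\,(\psi-\lambda\mathbb{G}_0(\psi))\,dx=\int_\Omega f\,\mathbb{G}_0(\psi)\,dx$ for all $\psi\in L^\infty_c(\Omega)$; (4) $\int_\Omega u\,(\psi-\lambda\mathbb{G}_0(\psi))\,dx=\int_\Omega f\,\mathbb{G}_0(\psi)\,dx$ for all $\psi\in C_c^\infty(\Omega)$; (5) $u=\lambda\mathbb{G}_0(u)+\mathbb{G}_0(f)$ a.e. in $\Omega$. If in addition $f\in L^2(\Omega)$ and $u\in\mathbb{H}^2_{\mathcal L}(\Omega)$, then each of the conditions (1), (2), (3), (4), (5) is equivalent to (6) $(\lambda_j-\lambda)\int_\Omega u\varphi_j\,dx=\int_\Omega f\varphi_j\,dx$ for all $j\ge1$.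
   Context: Setting. Let $n\ge1$, $s\in(0,1)$, $\Omega\subset\mathbb{R}^n$ be bounded of class $C^{1,1}$, $\delta(x)=\mathrm{dist}(x,\partial\Omega)$. $\mathcal L$ is a non-negative operator of order $2s$ in $\Omega$ with homogeneous Dirichlet condition; it enters through its Green function. (K1): $\mathcal L$ has a Green function $\mathcal G_0:(\Omega\times\Omega)\setminus\{x=y\}\to(0,\infty)$ with $\mathcal G_0(x,y)=\mathcal G_0(y,x)\asymp |x-y|^{-(n-2s)}\left(\frac{\delta^\gamma(x)\delta^\gamma(y)}{|x-y|^{2\gamma}}\wedge1\right)$ for some $\gamma\in(0,1]$, where $n\ne2s$. Here $f\asymp g$ means $C^{-1}f\le g\le Cf$ for a constant $C>0$, and $a\wedge b=\min\{a,b\}$. Green operator: $\mathbb G_0(f)(x)=\int_\Omega\mathcal G_0(x,y)f(y)\,dy$. It is compact and self-adjoint on $L^2(\Omega)$; standing: there are $0<\lambda_1\le\lambda_2\le\dots\nearrow+\infty$ (repeated according to multiplicity) and an orthonormal basis $(\varphi_j)_{j\ge1}\subset C(\overline\Omega)$ of $L^2(\Omega)$ with $\varphi_j=\lambda_j\mathbb G_0(\varphi_j)$, $\varphi_1\ge0$; moreover $\varphi_j\in\delta^\gamma L^\infty(\Omega)$. $\Sigma=\{\lambda_j\}$, and $\mathcal L$ is the inverse of $\mathbb G_0$ ($\mathcal L\varphi_j=\lambda_j\varphi_j$). Notation. $\langle f,\varphi\rangle=\int_\Omega f\varphi\,dx$. For a weight $w>0$: $L^1(\Omega;w)$ has norm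 $\|fw\|_{L^1(\Omega)}$; $wL^\infty(\Omega)=\{f:f/w\in L^\infty(\Omega)\}$ has norm $\|f/w\|_{L^\infty(\Omega)}$. $L^\infty_c(\Omega)$: bounded functions with compact support in $\Omega$. $\mathbb H^2_{\mathcal L}(\Omega)=\{v\in L^2(\Omega):\sum_j\lambda_j^2\langle v,\varphi_j\rangle^2<\infty\}$. For $\lambda\in\mathbb R\setminus\Sigma$, $\mathbb G_\lambda(f)=\sum_{j\ge1}\frac{\langle f,\varphi_j\rangle}{\lambda_j-\lambda}\varphi_j$ for $f\in L^2(\Omega)$, and $\mathbb G_\lambda:L^1(\Omega;\delta^\gamma)\to L^1(\Omega;\delta^\gamma)$ denotes the unique continuous extension of this operator. (Items (1)–(6) are the different notions of solution of $\mathcal Lu-\lambda u=f$ in $\Omega$ with zero weighted boundary trace.) *)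

(* Defs.v *)
From HB Require Import structures.
From mathcomp Require Import all_boot all_order all_algebra.
From mathcomp Require Import all_classical all_reals all_analysis.
From mathcomp Require Import measurable_realfun.

Set Implicit Arguments.
Unset Strict Implicit.
Unset Printing Implicit Defensive.

Import Order.TTheory GRing.Theory Num.Theory.
Import numFieldNormedType.Exports.

Local Open Scope classical_set_scope.
Local Open Scope ring_scope.

(* Borel sigma-algebra of R^n, as the product sigma-algebra: it is generated
   by the coordinate maps. *)
Section measurable_rV.
Context {R : realType}.
Variable n : nat.

Let coords : 'I_n -> 'rV[R]_n -> R := fun i x => x ord0 i.

Let rV_set0 : g_sigma_preimage coords set0.
Proof. exact: sigma_algebra0. Qed.

Let rV_setC A : g_sigma_preimage coords A -> g_sigma_preimage coords (~` A).
Proof. exact: sigma_algebraC. Qed.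

Let rV_bigcup (F : _^nat) : (forall i, g_sigma_preimage coords (F i)) ->
  g_sigma_preimage coords (\bigcup_i (F i)).
Proof. exact: sigma_algebra_bigcup. Qed.

HB.instance Definition _ := @isMeasurable.Build default_measure_display
  'rV[R]_n (g_sigma_preimage coords) rV_set0 rV_setC rV_bigcup.

End measurable_rV.

Lemma measurable_coord (R : realType) n (i : 'I_n) :
  measurable_fun [set: 'rV[R]_n] (fun x => x ord0 i).
Proof.
move=> _ Y mY; rewrite setTI; apply: sub_sigma_algebra => /=.
rewrite -bigcup_seq/=; exists i => /=; first by rewrite mem_index_enum.
by exists Y => //; rewrite setTI.
Qed.

Lemma measurable_fun_rVP d (T : measurableType d) (R : realType) n
    (f : T -> 'rV[R]_n) :
  (forall i, measurable_fun [set: T] (fun x => f x ord0 i)) ->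
  measurable_fun [set: T] f.
Proof.
move=> mf; suff h : g_sigma_preimage (fun (i : 'I_n) x => f x ord0 i)
    `<=` measurable.
  move=> _ A mA; apply: h.
  rewrite (g_sigma_preimage_comp (fun (i : 'I_n) (x : 'rV[R]_n) => x ord0 i) f).
  by exists A.
apply: smallest_sub; first exact: sigma_algebra_measurable.
case: n => [|n] in f mf *; first by rewrite big_ord0.
rewrite -bigcup_mkord_ord; apply: bigcup_sub => i Ii.
by move=> A [B mB <-]; exact: mf.
Qed.

Definition row_cons (R : realType) n (x : R) (v : 'rV[R]_n) : 'rV[R]_n.+1 :=
  \row_i oapp (v ord0) x (unlift ord0 i).

Lemma row_cons0 (R : realType) n (x : R) (v : 'rV[R]_n) :
  row_cons x v ord0 ord0 = x.
Proof. by rewrite mxE unlift_none. Qed.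

Lemma row_consS (R : realType) n (x : R) (v : 'rV[R]_n) i :
  row_cons x v ord0 (lift ord0 i) = v ord0 i.
Proof. by rewrite mxE liftK. Qed.

Lemma measurable_row_cons (R : realType) n : measurable_fun setT
  (fun z : R * 'rV[R]_n => row_cons z.1 z.2).
Proof.
apply: measurable_fun_rVP => i; case: (unliftP ord0 i) => [j|] ->.
  under eq_fun do rewrite row_consS.
  exact: (measurableT_comp (measurable_coord j) measurable_snd).
under eq_fun do rewrite row_cons0.
exact: measurable_fst.
Qed.

(* Lebesgue measure on R^n, by iterating the one-dimensional one:
   |A| = \int |{v : (x, v) \in A}| dx; see [lebesgue_rV_box]. *)
Fixpoint lebesgue_rV (R : realType) (n : nat) : set 'rV[R]_n -> \bar R :=
  if n is m.+1 then
    fun A => (\int[lebesgue_measure]_x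
                @lebesgue_rV R m [set v | A (row_cons x v)])%E
  else dirac (0 : 'rV[R]_0).
Arguments lebesgue_rV {R n}.

Section lebesgue_rV_measure.
Context {R : realType}.
Local Open Scope ereal_scope.

Lemma lebesgue_rV_set0 n : @lebesgue_rV R n set0 = 0.
Proof.
elim: n => [|n IHn]; first exact: (measure0 (dirac (0%R : 'rV[R]_0))).
by rewrite /=; apply: integral0_eq => x _; exact: IHn.
Qed.

Lemma lebesgue_rV_ge0 n (A : set 'rV[R]_n) : 0 <= lebesgue_rV A.
Proof.
elim: n A => [|n IHn] A; first exact: (measure_ge0 (dirac (0%R : 'rV[R]_0))).
by rewrite /=; apply: integral_ge0 => x _; exact: IHn.
Qed.

Lemma lebesgue_rV_box n (A : 'I_n -> set R) :
  (forall i, measurable (A i)) ->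
  lebesgue_rV [set v : 'rV[R]_n | forall i, A i (v ord0 i)] =
  \prod_(i < n) lebesgue_measure (A i).
Proof.
elim: n A => [|n IHn] A mA.
  rewrite big_ord0 (_ : [set _ | _] = setT)//; first by rewrite /= diracT.
  by apply/seteqP; split => // v _ [].
rewrite big_ord_recl/= -IHn; last by move=> i; exact: mA.
set c := lebesgue_rV _.
rewrite (eq_integral (fun x : measurableTypeR R => (\1_(A ord0) x)%:E * c));
  last first.
  move=> x _; rewrite indicE.
  have [/set_mem xA|/negP xA] := boolP (x \in A ord0).
    rewrite mul1e /c; congr lebesgue_rV; apply/seteqP; split => v /= h i.
      by rewrite -(row_consS x v); exact: h.
    by case: (unliftP ord0 i) => [j|] ->; rewrite ?row_consS ?row_cons0.
  rewrite mul0e (_ : [set _ | _] = set0) ?lebesgue_rV_set0//.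
  apply/seteqP; split => // v /= /(_ ord0); rewrite row_cons0 => xA0.
  by apply: xA; exact/mem_set.
rewrite ge0_integralZr//; last exact: lebesgue_rV_ge0.
  by rewrite integral_indic ?setIT //; exact: mA.
by apply/measurable_EFinP; apply: measurable_indic; exact: mA.
Qed.

Lemma lebesgue_rV_sigma_finite n : sigma_finite setT (@lebesgue_rV R n).
Proof.
exists (fun k => [set v : 'rV[R]_n | forall i,
    `[(- k%:R)%R, k%:R]%classic (v ord0 i)]).
  apply/esym/seteqP; split => // v _.
  exists (Num.truncn (\sum_i `|v ord0 i|)%R).+1 => //= i.
  have h : (`|v ord0 i| <= (Num.truncn (\sum_i `|v ord0 i|)).+1%:R)%R.
    rewrite ltW// (le_lt_trans _ (truncnS_gt _))//.
    by rewrite (bigD1 i)//= lerDl sumr_ge0.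
  by rewrite in_itv/= -ler_norml.
move=> k; split.
  rewrite (_ : [set _ | _] = \bigcap_(i in [set: 'I_n])
    ((fun v : 'rV[R]_n => v ord0 i) @^-1` `[(- k%:R)%R, k%:R]%classic)).
    apply: fin_bigcap_measurable => [//|i _]; rewrite -[X in measurable X]setTI.
    by apply: measurable_coord => //; exact: measurable_itv.
  by apply/seteqP; split => v /= h i; [move=> _|]; exact: h.
rewrite (@lebesgue_rV_box n (fun=> `[(- k%:R)%R, k%:R]%classic)); last first.
  by move=> i; exact: measurable_itv.
rewrite ltey_eq; apply/orP; left.
elim/big_ind : _ => //= [x y|i _]; first exact: fin_numM.
by rewrite lebesgue_measure_itv/=; case: ifP.
Qed.

Section step.
Variables (n : nat) (m : {measure set 'rV[R]_n -> \bar R}).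
Hypothesis sigma_finite_m : sigma_finite setT m.

Let m' : set 'rV[R]_n -> \bar R := m.

HB.instance Definition _ := Measure.on m'.
HB.instance Definition _ :=
  Measure_isSigmaFinite.Build _ _ _ m' sigma_finite_m.

Let f (z : measurableTypeR R * 'rV[R]_n) := row_cons z.1 z.2.

Let mf : measurable_fun [set: measurableTypeR R * 'rV[R]_n] f.
Proof. exact: measurable_row_cons. Qed.

Lemma lebesgue_rV_step : semi_sigma_additive (fun A : set 'rV[R]_n.+1 =>
  \int[lebesgue_measure]_x m [set v | A (row_cons x v)]).
Proof.
rewrite (_ : (fun A => _) = fun A => (lebesgue_measure \x m') (f @^-1` A)).
  move=> F mF tF mUF; rewrite preimage_bigcup.
  apply: measure_semi_sigma_additive.
  - by move=> k; rewrite -[X in measurable X]setTI; exact: mf.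
  - apply/trivIsetP => /= i j _ _ ij; rewrite -preimage_setI.
    by move/trivIsetP : tF => /(_ _ _ _ _ ij) ->//; rewrite preimage_set0.
  - by rewrite -preimage_bigcup -[X in measurable X]setTI; exact: mf.
apply/funext => A; apply: eq_integral => x _ /=; congr (m _).
by apply/seteqP; split => v; rewrite /xsection/= inE.
Qed.

End step.

Lemma lebesgue_rV_semi_sigma_additive n :
  semi_sigma_additive (@lebesgue_rV R n).
Proof.
elim: n => [|n IHn].
  exact: (@measure_semi_sigma_additive _ _ _ (dirac (0%R : 'rV[R]_0))).
pose H := isMeasure.Build _ _ _ (@lebesgue_rV R n) (lebesgue_rV_set0 n)
  (@lebesgue_rV_ge0 n) IHn.
pose m : {measure set 'rV[R]_n -> \bar R} := HB.pack (@lebesgue_rV R n) H.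
exact: (@lebesgue_rV_step n m (lebesgue_rV_sigma_finite n)).
Qed.

HB.instance Definition _ n := isMeasure.Build _ _ _ (@lebesgue_rV R n)
  (lebesgue_rV_set0 n) (@lebesgue_rV_ge0 n)
  (@lebesgue_rV_semi_sigma_additive n).

HB.instance Definition _ n := Measure_isSigmaFinite.Build _ _ _
  (@lebesgue_rV R n) (lebesgue_rV_sigma_finite n).

End lebesgue_rV_measure.

Section geometry.
Context {R : realType}.

(* The norm carried by ['rV[R]_n] in the library is the max norm. *)
Definition enorm n (x : 'rV[R]_n) : R := Num.sqrt (\sum_i x ord0 i ^+ 2).

Definition bdry n (Omega : set 'rV[R]_n) : set 'rV[R]_n :=
  closure Omega `\` interior Omega.

Definition dist_bdry n (Omega : set 'rV[R]_n) (x : 'rV[R]_n) : R :=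
  inf [set enorm (x - y) | y in bdry Omega].

Definition partial n (i : 'I_n) (f : 'rV[R]_n -> R) : 'rV[R]_n -> R :=
  fun x => 'D_(delta_mx ord0 i) f x.

Definition C11_function n (h : 'rV[R]_n -> R) : Prop :=
  (forall y, differentiable h y) /\
  exists K : R, forall (i : 'I_n) y z,
    `|partial i h y - partial i h z| <= K * enorm (y - z).

(* Near each boundary point, in suitable orthonormal coordinates [x *m Q], the
   set is the strict epigraph of a C^{1,1} function of the coordinates other
   than the [i]-th.  A C^{1,1} function near a point has a cut-off extension
   which is C^{1,1} on the whole space, so [h] can be taken globally defined. *)
Definition bounded_C11_open n (Omega : set 'rV[R]_n) : Prop :=
  [/\ open Omega, bounded_set Omega &
    forall x0, bdry Omega x0 ->
    exists2 r : R, 0 < r &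
    exists (Q : 'M[R]_n) (i : 'I_n) (h : 'rV[R]_n.-1 -> R),
      [/\ Q *m Q^T = 1%:M, C11_function h &
        forall x, enorm (x - x0) < r ->
          (Omega x <-> h (col' i (x *m Q)) < (x *m Q) ord0 i)]].

Definition smooth n (f : 'rV[R]_n -> R) : Prop :=
  forall (l : seq 'I_n) x, differentiable (foldr (@partial n) f l) x.

End geometry.

(* Functions on [Omega] are total functions on R^n of which only the values on
   [Omega] matter; classes modulo null sets are handled through their Borel
   representatives. *)
Section function_spaces.
Context {R : realType} {n : nat}.
Variable Omega : set 'rV[R]_n.
Local Notation mu := (@lebesgue_rV R n).
Implicit Types (f g w : 'rV[R]_n -> R).

Definition pairing f g : R := \int[mu]_(x in Omega) (f x * g x).

Definition L1w w f : Prop :=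
  measurable_fun Omega f /\
  mu.-integrable Omega (fun x => (f x * w x)%:E).

Definition L1w_norm w f : \bar R :=
  (\int[mu]_(x in Omega) (`|f x * w x|)%:E)%E.

Definition L2 f : Prop :=
  measurable_fun Omega f /\ mu.-integrable Omega (fun x => (f x ^+ 2)%:E).

Definition Linfty f : Prop :=
  measurable_fun Omega f /\
  exists M : R, \forall x \ae mu, Omega x -> `|f x| <= M.

Definition wLinfty w f : Prop :=
  measurable_fun Omega f /\ Linfty (fun x => f x / w x).

Definition Linfty_c f : Prop :=
  Linfty f /\
  exists K : set 'rV[R]_n, [/\ compact K, K `<=` Omega &
    \forall x \ae mu, Omega x -> ~ K x -> f x = 0].

Definition Cinfty_c f : Prop :=
  smooth f /\
  exists K : set 'rV[R]_n, [/\ compact K, K `<=` Omega &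
    forall x, ~ K x -> f x = 0].

(* [g] is the sum in L^2 of the series of general term [c j *: phi j]. *)
Definition L2_sum (c : nat -> R) (phi : nat -> 'rV[R]_n -> R) g : Prop :=
  L2 g /\
  (\int[mu]_(x in Omega) ((g x - \sum_(j < N) c j * phi j x) ^+ 2)%:E)%E
    @[N --> \oo] --> 0%E.

Definition orthonormal_basis (phi : nat -> 'rV[R]_n -> R) : Prop :=
  [/\ forall j, L2 (phi j),
      forall i j, pairing (phi i) (phi j) = (i == j)%:R &
      forall f, L2 f -> L2_sum (fun j => pairing f (phi j)) phi f].

End function_spaces.

Section operators.
Context {R : realType} {n : nat}.
Variable Omega : set 'rV[R]_n.
Local Notation mu := (@lebesgue_rV R n).
Implicit Types (G : 'rV[R]_n -> 'rV[R]_n -> R) (f v : 'rV[R]_n -> R).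

Definition dist_pow (gamma : R) (x : 'rV[R]_n) : R := dist_bdry Omega x `^ gamma.

Definition green_profile (s gamma : R) (x y : 'rV[R]_n) : R :=
  enorm (x - y) `^ (- (n%:R - 2 * s)) *
  Num.min (dist_pow gamma x * dist_pow gamma y / enorm (x - y) `^ (2 * gamma)) 1.

Record K1 (s gamma : R) G : Prop := {
  K1_dim : n%:R != 2 * s;
  K1_gamma : 0 < gamma <= 1;
  K1_measurable : measurable_fun
    [set z : 'rV[R]_n * 'rV[R]_n | [/\ Omega z.1, Omega z.2 & z.1 <> z.2]]
    (fun z => G z.1 z.2);
  K1_pos : forall x y, Omega x -> Omega y -> x <> y -> 0 < G x y;
  K1_sym : forall x y, Omega x -> Omega y -> x <> y -> G x y = G y x;
  K1_bounds : exists2 C : R, 0 < C &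
    forall x y, Omega x -> Omega y -> x <> y ->
      C^-1 * green_profile s gamma x y <= G x y
        <= C * green_profile s gamma x y }.

Definition green_op G f (x : 'rV[R]_n) : R :=
  \int[mu]_(y in Omega) (G x y * f y).

(* Indices start at 0: [lam j] and [phi j] stand for lambda_{j+1} and
   phi_{j+1}. *)
Record eigenbasis (gamma : R) G (lam : nat -> R) (phi : nat -> 'rV[R]_n -> R)
    : Prop := {
  lam_gt0 : 0 < lam 0;
  lam_nondecreasing : nondecreasing_seq lam;
  lam_cvg : lam @ \oo --> +oo;
  phi_continuous : forall j, {within closure Omega, continuous (phi j)};
  phi_basis : orthonormal_basis Omega phi;
  phi_eigen : forall j,
    \forall x \ae mu, Omega x -> phi j x = lam j * green_op G (phi j) x;
  phi0_ge0 : forall x, Omega x -> 0 <= phi 0 x;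
  phi_wLinfty : forall j, wLinfty Omega (dist_pow gamma) (phi j) }.

Definition H2L (lam : nat -> R) (phi : nat -> 'rV[R]_n -> R) v : Prop :=
  L2 Omega v /\
  cvgn (series (fun j => lam j ^+ 2 * pairing Omega v (phi j) ^+ 2)).

Definition L1w_continuous (w : 'rV[R]_n -> R)
    (T : ('rV[R]_n -> R) -> ('rV[R]_n -> R)) : Prop :=
  (forall f, L1w Omega w f -> L1w Omega w (T f)) /\
  forall f, L1w Omega w f -> forall e : R, 0 < e -> exists2 d : R, 0 < d &
    forall g, L1w Omega w g ->
      (L1w_norm Omega w (g \- f)%R < d%:E)%E ->
      (L1w_norm Omega w (T g \- T f)%R < e%:E)%E.

(* [T] is the continuous extension to L^1(Omega; delta^gamma) of the operator
   f |-> \sum_j <f, phi_j> / (lambda_j - lambda) phi_j on L^2(Omega).  As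
   L^2(Omega) is dense, these conditions determine [T f] up to a null set. *)
Definition is_resolvent (gamma : R) (lam : nat -> R)
    (phi : nat -> 'rV[R]_n -> R) (lambda : R)
    (T : ('rV[R]_n -> R) -> ('rV[R]_n -> R)) : Prop :=
  L1w_continuous (dist_pow gamma) T /\
  forall f, L2 Omega f ->
    L2_sum Omega (fun j => pairing Omega f (phi j) / (lam j - lambda)) phi (T f).

End operators.

(* Main.v *)
(** The Green operator [A] (integration against [G], with [w = delta^gamma]) and the
resolvent [T] are both symmetric for the duality between L^1(w) and
[w L^oo].  For [A] this is Fubini's theorem together with
[int G(x,y) w(y) dy <= C w(x)], which follows from (K1), the inequality
[|w(x) - w(y)| <= |x - y|^gamma] and the integrability of [|x|^(2s-n)] near 0.
For [T] it holds on L^2 by expansion in eigenfunctions; continuity on L^1(w)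
gives by duality that [T] maps [w L^oo] to itself, and the symmetry extends by
density.  Comparing eigenfunction coefficients,
[T (psi - lambda A psi) = A psi] and [A (psi + lambda T psi) = T psi] for [psi]
in [w L^oo]; these two identities turn the weak formulations into each other.
Passing from test functions back to equalities a.e. is the fundamental lemma of
the calculus of variations, whose test functions are the bumps
[prod_i exp(-1/(m(x_i - a_i))) exp(-1/(m(b_i - x_i)))]: they increase to the
indicator of a box as [m] grows. *)

Require Import Defs.
From mathcomp Require Import all_boot all_order all_algebra.
From mathcomp Require Import all_classical all_reals all_analysis.
From mathcomp Require Import measurable_realfun ring lra.
Import Order.TTheory GRing.Theory Num.Theory.
Import numFieldNormedType.Exports.
Set Implicit Arguments.
Unset Strict Implicit.
Unset Printing Implicit Defensive.
Local Open Scope classical_set_scope.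
Local Open Scope ring_scope.

(** ** Borel sets and Lebesgue measure of R^n *)

(** Two obstacles shape the argument. First, the resolvent is an arbitrary map on functions, known
    only through its continuity on L^1(w) and its series on L^2; linearity is not among its
    hypotheses, and its values matter up to null sets only. Hence the vanishing of its value at 0 is
    read off the series, boundedness is stated on a ball rather than through an operator norm, and
    symmetry is extended by continuity at f itself, since [T g - T f] is not known to be
    [T (g - f)]. Second, elements of L^1(w) need not be square integrable, so eigenfunction
    expansions are used for test functions only: operator identities are proved for psi in w L^oo,
    which lies in L^2 and in L^1(w), and are transferred to u and f by duality. Because [T]
    preserves this class, psi + lambda T psi is again a test function; this choice is what inverts
    the Green equation. *)

Section borel_rV.
Context {R : realType} {n : nat}.
Implicit Types (a b x y : 'rV[R]_n) (U : set 'rV[R]_n).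

Definition obox a b : set 'rV[R]_n :=
  [set v | forall i, a ord0 i < v ord0 i < b ord0 i].

Definition cbox a b : set 'rV[R]_n :=
  [set v | forall i, a ord0 i <= v ord0 i <= b ord0 i].

(** The argument [e] is a sign: -1 and 1 give the two opposite corners of a cube with rational
    centre [p.1] and half-side 1/([p.2] + 1). The index type is countable. *)
Definition rat_corner (e : R) (p : 'rV[rat]_n * nat) : 'rV[R]_n :=
  \row_i (ratr (p.1 ord0 i) + e * p.2.+1%:R^-1).

(** With half-side d < e/2 and a rational centre within d of x, every point of the closed cube is
    within 2d < e of x. The closed cube is kept inside [U] because integrability is available on
    compact boxes only. *)
Lemma open_rat_box U x : open U -> U x ->
  exists p, obox (rat_corner (-1) p) (rat_corner 1 p) x /\
            cbox (rat_corner (-1) p) (rat_corner 1 p) `<=` U.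
Proof.
rewrite openE => /(_ x) /[apply] /nbhs_ballP[e /= e0 xeU].
have /ltr_add_invr[k] : 0 < e / 2 by rewrite divr_gt0.
rewrite add0r => ke; pose d : R := k.+1%:R^-1.
have d0 : 0 < d by rewrite invr_gt0.
have qP i : {q : rat | ratr q \in `]x ord0 i - d, x ord0 i + d[}.
  by apply/cid; apply: rat_in_itvoo; rewrite ltrD2l gtrN.
exists (\row_i sval (qP i), k); split.
  move=> i; rewrite !mxE; have := svalP (qP i); rewrite in_itv/= -/d.
  by move: (ratr _) => r; lra.
move=> y bxy; apply: xeU; split => // i j; rewrite (ord1 i).
have := bxy j; rewrite !mxE /= -/d; have := svalP (qP j); rewrite in_itv/=.
move: (ratr _) => r; move: ke; rewrite -/d /ball/= ltr_norml; lra.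
Qed.

Lemma measurable_coord_preimage (i : 'I_n) (B : set R) : measurable B ->
  measurable [set v : 'rV[R]_n | B (v ord0 i)].
Proof.
move=> mB; rewrite -[X in measurable X]setTI.
exact: (@measurable_coord R n i measurableT).
Qed.

Lemma measurable_prod_sets (B : 'I_n -> set R) :
  (forall i, measurable (B i)) ->
  measurable [set v : 'rV[R]_n | forall i, B i (v ord0 i)].
Proof.
move=> mB; rewrite (_ : [set _ | _] = \bigcap_(i in [set: 'I_n])
    [set v : 'rV[R]_n | B i (v ord0 i)]); last first.
  by apply/seteqP; split => [v Bv i _|v Bv i]; exact: Bv.
by apply: fin_bigcap_measurable => // i _; exact: measurable_coord_preimage.
Qed.

Lemma oboxE a b : obox a b =
  [set v | forall i, `]a ord0 i, b ord0 i[%classic (v ord0 i)].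
Proof. by apply/seteqP; split => v /= h i; have := h i; rewrite in_itv. Qed.

Lemma cboxE a b : cbox a b =
  [set v | forall i, `[a ord0 i, b ord0 i]%classic (v ord0 i)].
Proof. by apply/seteqP; split => v /= h i; have := h i; rewrite in_itv. Qed.

Lemma measurable_obox a b : measurable (obox a b).
Proof.
rewrite oboxE; apply: (@measurable_prod_sets (fun i => `]a ord0 i, b ord0 i[%classic)) => i.
exact: measurable_itv.
Qed.

Lemma measurable_cbox a b : measurable (cbox a b).
Proof.
rewrite cboxE; apply: (@measurable_prod_sets (fun i => `[a ord0 i, b ord0 i]%classic)) => i.
exact: measurable_itv.
Qed.

Lemma obox_sub_cbox a b : obox a b `<=` cbox a b.
Proof. by move=> v h1 i; have /andP[/ltW -> /ltW ->] := h1 i. Qed.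

Lemma compact_cbox a b : compact (cbox a b).
Proof.
rewrite cboxE; apply: (@rV_compact _ _ (fun i => `[a ord0 i, b ord0 i]%classic)).
by move=> i; exact: segment_compact.
Qed.

Lemma measurable_set1_rV x : measurable [set x].
Proof.
rewrite (_ : [set x] = cbox x x); first exact: measurable_cbox.
apply/seteqP; split => [_ -> i|y xy]; first by rewrite lexx.
by apply/rowP => i; apply/eqP; rewrite eq_le andbC xy.
Qed.

(** The sigma-algebra is generated by coordinates, not by open sets; the two are reconciled by
    writing an open set as a union of rational boxes enumerated by [unpickle], indices without a
    suitable box contributing [set0]. *)
Lemma open_measurable_rV U : open U -> measurable U.
Proof.
move=> oU; pose P p := cbox (rat_corner (-1) p) (rat_corner 1 p) `<=` U.
pose F k := if unpickle k is Some p then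
  if `[< P p >] then obox (rat_corner (-1) p) (rat_corner 1 p) else set0
  else set0.
rewrite (_ : U = \bigcup_k F k).
  apply: bigcupT_measurable => k; rewrite /F; case: unpickle => // p.
  by case: ifP => // _; exact: measurable_obox.
apply/seteqP; split => [x /(open_rat_box oU)[p [xp pU]]|x [k _]].
  by exists (pickle p) => //; rewrite /F pickleK; case: asboolP.
rewrite /F; case: unpickle => // p; case: asboolP => // Pp xp; apply: Pp.
exact: obox_sub_cbox.
Qed.

Lemma continuous_measurable_rV (f : 'rV[R]_n -> R) : continuous f ->
  measurable_fun setT f.
Proof.
move=> /continuousP cf; apply: (measurability _ (RGenOpens.measurableE R)).
move=> _ [_ [a [b ->] <-]]; rewrite setTI; apply: open_measurable_rV.
exact/cf/itv_open.
Qed.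

Lemma lebesgue_rV_cube x (r : R) : 0 <= r ->
  @lebesgue_rV R n [set y : 'rV[R]_n | forall i, `|x ord0 i - y ord0 i| <= r] =
  ((2 * r) ^+ n)%:E :> \bar R.
Proof.
move=> r0; pose A i : set R := `[x ord0 i - r, x ord0 i + r]%classic.
rewrite (_ : [set _ | _] = [set y : 'rV[R]_n | forall i, A i (y ord0 i)]).
  rewrite lebesgue_rV_box; last by move=> i; exact: measurable_itv.
  have AE i : lebesgue_measure (A i) = (2 * r)%:E.
    rewrite /A lebesgue_measure_itv/= lte_fin; case: ifPn => [_|].
      by rewrite -EFinB; congr EFin; ring.
    by rewrite -leNgt => h; congr EFin; lra.
  under eq_bigr do rewrite AE.
  by rewrite prodEFin prodr_const card_ord.
apply/seteqP; split => y /= h i; have := h i; rewrite /A/= in_itv/= ler_norml;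
  lra.
Qed.

(** A point is a cube of side 0, of measure 0^n; in dimension 0 this would be 1. *)
Lemma lebesgue_rV_set1 x : (0 < n)%N -> lebesgue_rV [set x] = 0%E.
Proof.
move=> n0; rewrite [RHS](_ : _ = ((2 * 0) ^+ n)%:E :> \bar R); last first.
  by rewrite mulr0 expr0n gtn_eqF.
rewrite -(@lebesgue_rV_cube x 0)//; congr lebesgue_rV.
apply/seteqP; split => [_ -> i|y /= xy]; first by rewrite subrr normr0.
apply/rowP => i; apply/eqP; rewrite eq_sym -subr_eq0 -normr_eq0.
by rewrite eq_le normr_ge0 xy.
Qed.

Lemma measurable_bounded_lebesgue_rV U : measurable U -> bounded_set U ->
  (lebesgue_rV U < +oo)%E.
Proof.
move=> mU [M [_ /(_ (`|M| + 1))]] MU.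
have {}MU : forall x, U x -> `|x| <= `|M| + 1.
  by apply: MU; rewrite (le_lt_trans (ler_norm _))// ltrDl.
apply: (@le_lt_trans _ _ (lebesgue_rV
    [set y : 'rV[R]_n | forall i, `|(0 : 'rV[R]_n) ord0 i - y ord0 i| <= `|M| + 1])).
  apply: le_measure; rewrite ?inE//.
    rewrite (_ : [set _ | _] = cbox (const_mx (- (`|M| + 1))) (const_mx (`|M| + 1))).
      exact: measurable_cbox.
    by apply/seteqP; split => y /= h i; have := h i; rewrite !mxE sub0r normrN ler_norml.
  move=> y Uy /= i; rewrite mxE sub0r normrN (le_trans _ (MU _ Uy))//.
  by rewrite [leRHS]mx_normrE (le_bigmax _ (fun ij => `|y ij.1 ij.2|) (ord0, i)).
by rewrite lebesgue_rV_cube ?ltry// addr_ge0.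
Qed.

Lemma measurable_neq_rV :
  measurable [set z : 'rV[R]_n * 'rV[R]_n | z.1 <> z.2].
Proof.
rewrite (_ : [set _ | _] = \bigcup_(i in [set: 'I_n])
    [set z : 'rV[R]_n * 'rV[R]_n | z.1 ord0 i - z.2 ord0 i != 0]).
  apply: fin_bigcup_measurable => // i _; rewrite -[X in measurable X]setTI.
  rewrite (_ : [set _ | _] = (fun z : 'rV[R]_n * 'rV[R]_n =>
      z.1 ord0 i - z.2 ord0 i) @^-1` (~` [set 0])).
    have /(_ measurableT) := measurable_funB
      (measurableT_comp (measurable_coord i) (@measurable_fst _ _ 'rV[R]_n 'rV[R]_n))
      (measurableT_comp (measurable_coord i) (@measurable_snd _ _ 'rV[R]_n 'rV[R]_n)).
    by apply; exact: measurableC.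
  by apply/seteqP; split => z /= /eqP.
apply/seteqP; split => [z /= zz|z [i _ /= /eqP h]]; last first.
  by move=> zz; apply: h; rewrite zz subrr.
apply: contrapT => h; apply: zz; apply/rowP => i; apply/eqP.
rewrite -subr_eq0; apply/negPn/negP => hi; apply: h; by exists i.
Qed.

End borel_rV.

(** ** Euclidean distance and the Riesz kernel *)

Section euclidean_norm.
Context {R : realType} {n : nat}.
Implicit Types (x y : 'rV[R]_n) (A : set 'rV[R]_n).

Lemma enorm_ge0 x : 0 <= enorm x.
Proof. exact: sqrtr_ge0. Qed.

Lemma enorm_sqr x : enorm x ^+ 2 = \sum_i x ord0 i ^+ 2.
Proof. by rewrite sqr_sqrtr// sumr_ge0// => i _; exact: sqr_ge0. Qed.

Lemma coord_le_enorm x i : `|x ord0 i| <= enorm x.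
Proof.
rewrite -sqrtr_sqr ler_wsqrtr// (bigD1 i)//= lerDl sumr_ge0// => j _.
exact: sqr_ge0.
Qed.

Lemma enorm_eq0 x : (enorm x == 0) = (x == 0).
Proof.
apply/eqP/eqP => [x0|->]; last first.
  rewrite /enorm big1 ?sqrtr0// => i _.
  by rewrite mxE expr0n.
apply/rowP => i; rewrite mxE; apply/eqP.
by rewrite -normr_le0 -x0 coord_le_enorm.
Qed.

Lemma enorm_gt0 x : (0 < enorm x) = (x != 0).
Proof. by rewrite lt_neqAle enorm_ge0 andbT eq_sym enorm_eq0. Qed.

Lemma enormC x y : enorm (x - y) = enorm (y - x).
Proof.
by congr Num.sqrt; apply: eq_bigr => i _; rewrite !mxE -sqrrN opprB.
Qed.

(** With a and b the two norms, coordinates satisfy (p + q)^2 <= (a+b)/a p^2 + (a+b)/b q^2, the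
    defect being (bp - aq)^2/(ab). Summing gives (a+b)^2 on the right, without the Cauchy-Schwarz
    inequality. *)
Lemma enormD x y : enorm (x + y) <= enorm x + enorm y.
Proof.
have [/eqP|x0] := eqVneq (enorm x) 0.
  by rewrite enorm_eq0 => /eqP ->; rewrite add0r lerDr enorm_ge0.
have [/eqP|y0] := eqVneq (enorm y) 0.
  by rewrite enorm_eq0 => /eqP ->; rewrite addr0 lerDl enorm_ge0.
have {}x0 : 0 < enorm x by rewrite lt_neqAle eq_sym x0 enorm_ge0.
have {}y0 : 0 < enorm y by rewrite lt_neqAle eq_sym y0 enorm_ge0.
rewrite -(@ler_pXn2r _ 2)// ?nnegrE ?addr_ge0 ?enorm_ge0// enorm_sqr.
set a := enorm x in x0 *; set b := enorm y in y0 *.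
have -> : (a + b) ^+ 2 = (a + b) / a * a ^+ 2 + (a + b) / b * b ^+ 2.
  by field; rewrite !gt_eqF.
rewrite !enorm_sqr !mulr_sumr -big_split/=; apply: ler_sum => i _.
rewrite mxE; move: (x _ _) (y _ _) => p q.
rewrite -subr_ge0 (_ : _ - _ = (b * p - a * q) ^+ 2 / (a * b)).
  by rewrite divr_ge0 ?sqr_ge0// mulr_ge0// ltW.
by field; rewrite !gt_eqF.
Qed.

Lemma enorm_triangle x y (z : 'rV[R]_n) : enorm (x - z) <= enorm (x - y) + enorm (y - z).
Proof. by rewrite -(subrKA y x (- z)) enormD. Qed.

Lemma enorm_le_norm x : enorm x <= n%:R * `|x|.
Proof.
rewrite -(@ler_pXn2r _ 2)// ?nnegrE ?enorm_ge0// enorm_sqr.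
apply: (@le_trans _ _ (\sum_(i < n) `|x| ^+ 2)).
  apply: ler_sum => i _; rewrite -real_normK ?num_real// ler_pXn2r ?nnegrE//.
  by rewrite [leRHS]mx_normrE (le_bigmax _ (fun ij => `|x ij.1 ij.2|) (ord0, i)).
rewrite sumr_const card_ord exprMn -[leLHS]mulr_natl ler_wpM2r ?sqr_ge0//.
by rewrite -natrX ler_nat -mulnn; case: (n) => // m; rewrite leq_pmull.
Qed.

Lemma bounded_enorm A : bounded_set A -> exists2 D : R, 0 < D &
  forall x, A x -> enorm x <= D.
Proof.
move=> [M [_ /(_ (`|M| + 1))]] MU; exists (n%:R * (`|M| + 1) + 1).
  by rewrite ltr_wpDl// mulr_ge0// addr_ge0.
move=> x Ax; rewrite (le_trans (enorm_le_norm _))//.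
rewrite (@le_trans _ _ (n%:R * (`|M| + 1)))// ?lerDl// ler_wpM2l//.
by apply: MU => //; rewrite (le_lt_trans (ler_norm _))// ltrDl.
Qed.

Lemma dist_bdry_ge0 A x : 0 <= dist_bdry A x.
Proof.
rewrite /dist_bdry; set S := [set _ | _ in _].
have [->|/set0P S0] := eqVneq S set0; first by rewrite inf0.
by apply: lb_le_inf => // _ [y _ <-]; exact: enorm_ge0.
Qed.

Lemma dist_bdry_le A x y : bdry A y -> dist_bdry A x <= enorm (x - y).
Proof.
move=> Ay; apply: ge_inf; last by exists y.
by exists 0 => _ [z _ <-]; exact: enorm_ge0.
Qed.

Lemma dist_bdry_lipschitz A x y :
  dist_bdry A x <= dist_bdry A y + enorm (x - y).
Proof.
(* If the boundary is empty, the distance is the infimum of the empty set, which is 0 by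
   convention. *)
have [A0|/set0P[b Ab]] := eqVneq (bdry A) set0.
  by rewrite /dist_bdry A0 !image_set0 inf0 add0r enorm_ge0.
rewrite -lerBlDr; apply: lb_le_inf; first by exists (enorm (y - b)), b.
move=> _ [c Ac <-]; rewrite lerBlDr addrC.
by rewrite (le_trans (dist_bdry_le x Ac))// enorm_triangle.
Qed.

Lemma continuous_dist_bdry A : continuous (dist_bdry A).
Proof.
move=> x; apply/(@cvgrPdist_le _ _ _ (nbhs x) (nbhs_filter x)) => /= e e0; near=> y.
have xy : enorm (x - y) <= e.
  rewrite (le_trans (enorm_le_norm _))//.
  rewrite (@le_trans _ _ (n.+1%:R * `|x - y|))// ?ler_wpM2r// ?ler_nat//.
  rewrite mulrC -ler_pdivlMr//; near: y.
  by apply: cvgr_dist_le => //; rewrite divr_gt0.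
rewrite ler_norml; apply/andP; split.
  rewrite lerNl opprB lerBlDl (le_trans (dist_bdry_lipschitz _ _ x))//.
  by rewrite lerD2l enormC.
by rewrite lerBlDl (le_trans (dist_bdry_lipschitz _ _ y))// lerD2l.
Unshelve. all: by end_near. Qed.

Lemma powR_subadditive (p q g : R) : 0 <= p -> 0 <= q -> 0 < g <= 1 ->
  (p + q) `^ g <= p `^ g + q `^ g.
Proof.
move=> p0 q0 /andP[g0 g1]; have [->|pn] := eqVneq p 0.
  by rewrite powR0 ?gt_eqF// !add0r.
have {pn}p0' : 0 < p by rewrite lt_neqAle eq_sym pn.
have pq0 : 0 < p + q by rewrite ltr_wpDr.
(* This is t <= t^g on [0,1], for t = r/(p+q); the cases r = p and r = q add up to the claim. *)
have h r : 0 <= r -> r <= p + q -> r / (p + q) * (p + q) `^ g <= r `^ g.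
  move=> r0 rpq; have [->|rn] := eqVneq r 0.
    by rewrite !mul0r powR_ge0.
  have t0 : 0 < r / (p + q) by rewrite divr_gt0// lt_neqAle eq_sym rn.
  rewrite -[r in leRHS](divfK (lt0r_neq0 pq0)) powRM ?(ltW t0) ?(ltW pq0)//.
  rewrite ler_wpM2r ?powR_ge0// ger1_powR// t0/= ler_pdivrMr//.
  by rewrite mul1r.
rewrite (le_trans _ (lerD (h p _ _) (h q _ _))) ?lerDl ?lerDr//.
by rewrite -mulrDl -mulrDl divff ?mul1r// gt_eqF.
Qed.

End euclidean_norm.

(** * Uniform bound for the Riesz potential of a bounded set *)

Section riesz_kernel.
Context {R : realType} {n : nat}.
Variables (Omega : set 'rV[R]_n) (s : R).
Hypotheses (n_gt0 : (0 < n)%N) (s_gt0 : 0 < s).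
Local Notation mu := (@lebesgue_rV R n).

Lemma dyadic_scale (D r : R) : 0 < r -> r <= D ->
  exists k, D / 2 ^+ k.+1 < r <= D / 2 ^+ k.
Proof.
move=> r0 rD; have D0 : 0 < D by exact: lt_le_trans rD.
have ex : exists k, D / 2 ^+ k.+1 < r.
  exists (Num.truncn (D / r)); rewrite ltr_pdivrMr ?exprn_gt0// mulrC.
  rewrite -ltr_pdivrMr// (lt_trans (truncnS_gt _))// -natrX ltr_nat.
  exact: ltn_expl.
case: (ex_minnP ex) => -[|k] Pk mk.
  by exists 0%N; rewrite Pk expr0 divr1.
exists k.+1; by rewrite Pk/= leNgt; apply/negP => /mk; rewrite ltnn.
Qed.

(** On this shell 2D/2^k <= 4r, so the volume factor divided by r^n is at most 4^n, while r^(2s) <=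
    (D/2^k)^(2s). The sign of n - 2s does not matter. *)
Lemma riesz_kernel_dyadic (D r : R) k : 0 < D -> D / 2 ^+ k.+1 < r <= D / 2 ^+ k ->
  r `^ (- (n%:R - 2 * s)) * (2 * (D / 2 ^+ k)) ^+ n <=
  4 ^+ n * D `^ (2 * s) * (2^-1 `^ (2 * s)) ^+ k.
Proof.
move=> D0 /andP[rl ru].
have r0 : 0 < r by rewrite (lt_trans _ rl)// divr_gt0// exprn_gt0.
rewrite opprB powRB ?(gt_eqF r0) ?implybT// powR_mulrn ?(ltW r0)//.
have -> : 4 ^+ n * D `^ (2 * s) * (2^-1 `^ (2 * s)) ^+ k =
    (D / 2 ^+ k) `^ (2 * s) * 4 ^+ n.
  have e0 : 0 <= (2 ^+ k)^-1 :> R by rewrite invr_ge0 exprn_ge0.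
  rewrite (powRM _ (ltW D0) e0).
  have h0 : 0 <= 2^-1 :> R by rewrite invr_ge0.
  rewrite -exprVn -(powR_mulrn k h0) powRAC powR_mulrn ?powR_ge0//; ring.
rewrite -mulrA ler_pM ?powR_ge0//.
- by rewrite mulr_ge0 ?invr_ge0 ?exprn_ge0// ?mulr_ge0 ?divr_ge0 ?exprn_ge0 ?(ltW r0)// ltW.
- apply: ge0_ler_powR; rewrite ?nnegrE ?mulr_ge0 ?(ltW r0) ?(ltW s_gt0)//.
  exact: ltW.
rewrite mulrC -expr_div_n ler_pXn2r ?nnegrE//; last first.
  by rewrite !mulr_ge0 ?invr_ge0 ?(ltW r0) ?(ltW D0) ?exprn_ge0.
rewrite ler_pdivrMr//; move: rl; rewrite exprS invfM.
have : 0 < 2 ^+ k :> R by rewrite exprn_gt0.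
move: (2 ^+ k) => z z0; set t := D / z; have -> : D * (2^-1 * z^-1) = t / 2.
  by rewrite /t; field; rewrite gt_eqF.
lra.
Qed.

Hypotheses (mOmega : measurable Omega) (bOmega : bounded_set Omega).

Lemma measurable_enorm : measurable_fun [set: 'rV[R]_n] (@enorm R n).
Proof.
apply: (measurableT_comp (continuous_measurable_fun (@sqrt_continuous R))).
apply: measurable_sum => i.
exact: (measurable_funX 2 (measurable_coord i)).
Qed.

(** The kernel is dominated by the sum of c_k times the indicators of cubes [B k] of half-side D/2^k
    around y. Dividing by the volume in c_k makes the k-th integral at most C q^k with q = 2^(-2s) <
    1, whence the geometric bound C/(1-q), uniform in y. Here D bounds the diameter. *)
Lemma riesz_potential_bounded : n%:R != 2 * s ->
  exists2 K : R, 0 < K & forall y, Omega y ->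
    (\int[mu]_(x in Omega) (enorm (x - y) `^ (- (n%:R - 2 * s)))%:E <= K%:E)%E.
Proof.
move=> ns; have [D0 D0_gt0 D0P] := bounded_enorm bOmega.
pose D := D0 + D0; have D_gt0 : 0 < D by rewrite addr_gt0.
pose q : R := 2^-1 `^ (2 * s).
have q0 : 0 < q by rewrite powR_gt0.
have q1 : q < 1.
  have -> : 1 = 1 `^ (2 * s) :> R by rewrite powR1.
  rewrite gt0_ltr_powR ?nnegrE ?mulr_gt0//.
  by rewrite invf_lt1// ltr1n.
pose C := 4 ^+ n * D `^ (2 * s).
have C0 : 0 < C by rewrite mulr_gt0 ?exprn_gt0 ?powR_gt0.
exists (C / (1 - q)); first by rewrite divr_gt0 ?subr_gt0.
move=> y Oy.
pose B k := [set x : 'rV[R]_n | forall i, `|y ord0 i - x ord0 i| <= D / 2 ^+ k].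
have mB k : measurable (B k).
  rewrite (_ : B k = cbox (\row_i (y ord0 i - D / 2 ^+ k)) (\row_i (y ord0 i + D / 2 ^+ k))).
    exact: measurable_cbox.
  by apply/seteqP; split => x /= h i; have := h i; rewrite !mxE ler_distlC.
pose c k := C * q ^+ k / (2 * (D / 2 ^+ k)) ^+ n.
have dk_gt0 k : 0 < D / 2 ^+ k by rewrite divr_gt0 ?exprn_gt0.
have c_gt0 k : 0 < c k.
  apply: divr_gt0; first by rewrite mulr_gt0// exprn_gt0.
  by apply: exprn_gt0; rewrite pmulr_rgt0.
have c0 k : 0 <= c k by exact: ltW.
pose F k x := (c k * \1_(B k) x)%:E.
have F0 k x : (0 <= F k x)%E by rewrite lee_fin mulr_ge0.
have mF k (E : set 'rV[R]_n) : measurable_fun E (F k).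
  apply/measurable_EFinP; apply: measurable_funM => //.
apply: (@le_trans _ _ (\int[mu]_(x in Omega) \sum_(k <oo) F k x)%E).
  apply: ge0_le_integral => //.
  - by move=> x _; rewrite lee_fin powR_ge0.
  - apply/measurable_EFinP; apply: (measurableT_comp (measurable_powR _)).
    apply: (measurableT_comp measurable_enorm).
    apply: measurable_funTS; apply: measurable_fun_rVP => i; under eq_fun do rewrite !mxE.
    by apply: measurable_funB => //; exact: measurable_coord.
  - by apply: ge0_emeasurable_sum => // k x _ _; exact: F0.
  move=> x Ox; have [->|xy] := eqVneq x y.
    (* On the diagonal the kernel is a power of 0 with exponent 2s - n, equal to 0 because the
       exponent is non-zero. *)
    rewrite subrr (eqP (_ : enorm 0 == 0)) ?enorm_eq0// powR0.
      by apply: nneseries_ge0 => k _ _; exact: F0.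
    by rewrite oppr_eq0 subr_eq0.
  have r0 : 0 < enorm (x - y) by rewrite enorm_gt0 subr_eq0.
  have rD : enorm (x - y) <= D.
    rewrite (le_trans (enorm_triangle x 0 y))// lerD//; first by rewrite subr0 D0P.
    by rewrite (enormC 0 y) subr0 D0P.
  have [k kP] := dyadic_scale r0 rD.
  apply: (@le_trans _ _ (F k x)); last first.
    apply: (le_trans _ (nneseries_lim_ge k.+1 _)) => [|j _ _]; last exact: F0.
    by rewrite big_nat_recr//= leeDr// sume_ge0.
  rewrite lee_fin indicE mem_set; last first.
    move=> i; rewrite (le_trans _ (andP kP).2)// enormC.
    by have := coord_le_enorm (y - x) i; rewrite !mxE.
  rewrite mulr1 ler_pdivlMr; first exact: riesz_kernel_dyadic.
  by rewrite exprn_gt0// mulr_gt0.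
rewrite integral_nneseries//.
apply: lime_le.
  by apply: is_cvg_nneseries => k _ _; apply: integral_ge0 => x _; exact: F0.
apply: nearW => N.
apply: (@le_trans _ _ (\sum_(0 <= k < N) (C * q ^+ k)%:E)%E).
  apply: lee_sum => k _; rewrite /F.
  under eq_integral do rewrite EFinM.
  rewrite ge0_integralZl_EFin//; last by apply/measurable_EFinP; by apply: measurable_indic.
  rewrite integral_indic//.
  apply: (@le_trans _ _ ((c k)%:E * mu (B k))%E).
    rewrite lee_pmul2l ?lte_fin//.
    by apply: le_measure; rewrite ?inE//; exact: measurableI.
  rewrite lebesgue_rV_cube ?(ltW (dk_gt0 _))//.
  by rewrite -EFinM lee_fin divfK// gt_eqF// exprn_gt0// mulr_gt0.
rewrite sumEFin lee_fin.
have := @geometric_le_lim R N C q (ltW C0) q0.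
by rewrite ger0_norm ?(ltW q0)//; exact.
Qed.

End riesz_kernel.

(** ** Smooth bump functions *)

Section flat_function.
Context {R : realType}.
Implicit Types (t : R) (k : nat).

Definition flat k t : R := if 0 < t then t^-1 ^+ k * expR (- t^-1) else 0.

(** The factorial comes from e^v >= v^(k+2)/(k+2)! at v = 1/t. The exponent 2 is what makes the
    derivative vanish at 0. *)
Lemma flat_bound k t : `|flat k t| <= k.+2`!%:R * t ^+ 2.
Proof.
rewrite /flat; case: ifPn => [t0|_]; last first.
  by rewrite normr0 mulr_ge0// sqr_ge0.
have u0 : 0 < t^-1 by rewrite invr_gt0.
rewrite ger0_norm; last by rewrite mulr_ge0 ?expR_ge0// exprn_ge0// ltW.
rewrite expRN.
rewrite ler_pdivrMr ?expR_gt0//.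
have f0 : 0 < k.+2`!%:R :> R by rewrite ltr0n fact_gt0.
have h := @expR_ge1Dxn R t^-1 k.+1 (ltW u0).
have -> : t^-1 ^+ k = k.+2`!%:R * t ^+ 2 * (t^-1 ^+ k.+2 / k.+2`!%:R).
  rewrite (exprS _ k.+1) (exprS _ k); move: (t^-1 ^+ k) (k.+2`!%:R) f0 => a b b0; field.
  by rewrite !gt_eqF.
apply: ler_wpM2l; first by rewrite mulr_ge0 ?sqr_ge0.
by rewrite (le_trans _ h)// lerDr.
Qed.

Lemma is_derive_flat k t :
  is_derive t 1 (flat k) (flat k.+2 t - k%:R * flat k.+1 t).
Proof.
have [t0|t0|->] := ltgtP t 0.
- apply: (@near_eq_is_derive _ _ _ (cst 0)).
  + near=> x; rewrite /flat ifF//; apply/negbTE; rewrite -leNgt ltW//.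
    by near: x; exact: lt_nbhsl.
  + by rewrite /flat !ifF ?mulr0 ?subr0; [exact: is_derive_cst|
      rewrite ltNge ltW..].
- apply: (@near_eq_is_derive _ _ _ ((fun u => u ^+ k * expR (- u)) \o GRing.inv)).
  + near=> x; rewrite /flat/= ifT//.
    by near: x; exact: lt_nbhsr.
  have tn0 : t != 0 by rewrite gt_eqF.
  have dV : is_derive t 1 (GRing.inv : R -> R) (- t ^- 2).
    have := @is_deriveV R id t 1 1 tn0 _; rewrite [_ *: 1]mulr1.
    exact.
  have dE (u : R) : is_derive u (1 : R) (fun u => u ^+ k * expR (- u))
     (k%:R * u ^+ k.-1 * expR (- u) - u ^+ k * expR (- u)).
    have h : is_derive u 1 (expR \o -%R) (expR (- u) * - 1).
      exact: is_derive1_comp.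
    have p : is_derive u (1 : R) (fun x : R => x ^+ k) (k%:R * u ^+ k.-1).
      have := @is_deriveX _ _ (id : R -> R) k u 1 1 _.
      rewrite /GRing.scale/= mulr1 (_ : _ ^+ k = fun x => x ^+ k); first exact.
      by apply/funext => x; rewrite fctE.
    apply: (is_derive_eq (is_deriveM p h)).
    by rewrite /GRing.scale/=; ring.
  apply: (is_derive_eq (is_derive1_comp (dE _) dV)).
  rewrite /flat t0 -exprVn; case: k dE => [|k] dE /=; rewrite !exprS ?expr0; ring.
(* At 0 the difference quotient is at most (k+2)! |h| by [flat_bound]. *)
have q : (fun h => h^-1 *: ((flat k \o shift 0) (h *: 1) - flat k 0)) @ 0^' --> (0 : R).
  apply/cvgr0Pnorm_le => e e0; near=> h.
  have h0 : h != 0 by near: h; exact: nbhs_dnbhs_neq.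
  have -> : flat k 0 = 0 by rewrite /flat ltxx.
  rewrite subr0 /shift/= addr0 [h *: 1]mulr1 normrM normfV.
  rewrite mulrC ler_pdivrMr ?normr_gt0//.
  rewrite (le_trans (flat_bound k h))// -real_normK ?num_real// expr2 mulrA.
  rewrite ler_wpM2r// -ler_pdivlMl ?ltr0n ?fact_gt0//.
  near: h; apply: nbhs_dnbhs; apply: (@cvgr0_norm_le _ _ _ (nbhs (0:R)) _ id) => //.
  by rewrite mulr_gt0// invr_gt0 ltr0n fact_gt0.
apply: DeriveDef; first by apply/cvg_ex; exists 0.
rewrite /flat !ltxx mulr0 subr0; exact: (cvg_lim _ q).
Unshelve. all: by end_near. Qed.

Lemma flat_ge0 k t : 0 <= flat k t.
Proof.
by rewrite /flat; case: ifPn => // t0; rewrite mulr_ge0 ?exprn_ge0 ?expR_ge0// invr_ge0 ltW.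
Qed.

Lemma flat0_le1 t : flat 0 t <= 1.
Proof.
rewrite /flat; case: ifPn => // t0; rewrite expr0 mul1r expR_le1 oppr_le0.
by rewrite invr_ge0 ltW.
Qed.

Lemma flat_le0 k t : t <= 0 -> flat k t = 0.
Proof. by rewrite /flat leNgt => /negbTE ->. Qed.

Lemma cvg_flat0 t : 0 < t -> flat 0 (m.+1%:R * t) @[m --> \oo] --> (1 : R).
Proof.
move=> t0; have h m : flat 0 (m.+1%:R * t) = expR (- (m.+1%:R^-1 * t^-1)).
  by rewrite /flat mulr_gt0// expr0 mul1r invfM.
under eq_fun do rewrite h.
have : expR (- (m.+1%:R^-1 * t^-1)) @[m --> \oo] --> expR (- (0 * t^-1)).
  apply: continuous_cvg; first exact: continuous_expR.
  by apply: cvgN; apply: cvgMr_tmp; exact: cvg_harmonic.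
by rewrite mul0r oppr0 expR0.
Qed.

End flat_function.

(** * An algebra of smooth functions containing the bumps of boxes *)

Section bump_functions.
Context {R : realType} {n : nat}.
Implicit Types (f g : 'rV[R]_n -> R).

(* Stable under partial derivatives because
   [(flat k)' = flat k.+2 - k * flat k.+1]. *)
Inductive bump : ('rV[R]_n -> R) -> Prop :=
| bump_cst c : bump (fun=> c)
| bump_flat k a b i : bump (fun x => flat k (a * x ord0 i + b))
| bumpD f g : bump f -> bump g -> bump (fun x => f x + g x)
| bumpM f g : bump f -> bump g -> bump (fun x => f x * g x).

Lemma differentiable_bump f : bump f -> forall x, differentiable f x.
Proof.
elim=> [c|k a b i|{}f g _ hf _ hg|{}f g _ hf _ hg] x.
- exact: differentiable_cst.
- apply: (@differentiable_comp _ _ _ _ (fun x : 'rV[R]_n => a * x ord0 i + b) (flat k)).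
    apply: differentiableD; last exact: differentiable_cst.
    apply: differentiableM; first exact: differentiable_cst.
    exact: differentiable_coord.
  by apply/derivable1_diffP; have [] := is_derive_flat k (a * x ord0 i + b).
- exact: (differentiableD (hf x) (hg x)).
- exact: (differentiableM (hf x) (hg x)).
Qed.

Lemma bump_partial f i : bump f -> bump (partial i f).
Proof.
elim=> [c|k a b j|{}f g bf hf bg hg|{}f g bf hf bg hg].
- rewrite (_ : partial i _ = fun=> 0); first exact: bump_cst.
  by apply/funext => x; rewrite /partial derive_cst.
- rewrite (_ : partial i _ = fun x =>
      a * (delta_mx ord0 i : 'rV[R]_n) ord0 j *
      (flat k.+2 (a * x ord0 j + b) + - k%:R * flat k.+1 (a * x ord0 j + b))).
    by do !constructor.
  apply/funext => x; set d : 'rV[R]_n := delta_mx _ _; rewrite /partial -/d.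
  (* Along the line x + h d the argument of [flat k] is affine in h, so the directional derivative
     reduces to the one-variable chain rule at h = 0. *)
  pose l h : R := a * d ord0 j * h + (a * x ord0 j + b).
  have -> : 'D_d (fun x : 'rV[R]_n => flat k (a * x ord0 j + b)) x = 'D_1 (flat k \o l) 0.
    rewrite /derive; set p := (fun _ : R => _); set q := (fun _ : R => _).
    suff -> : p = q by []; apply/funext => h; rewrite /p /q /=.
    rewrite /l/= addr0 mulr0 add0r [h *: 1]mulr1 !mxE; congr (_ *: (flat k _ - _)).
    by ring.
  have dl : is_derive (0 : R) 1 l (a * d ord0 j).
    have -> : l = (a * d ord0 j) \*: id + cst (a * x ord0 j + b) by [].
    by apply: (is_derive_eq (is_deriveD _ _)); rewrite addr0 [_ *: 1]mulr1.
  have dc := @is_derive1_comp R (flat k) l 0 _ _ (is_derive_flat _ _) dl.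
  by rewrite (@derive_val _ _ _ _ _ _ _ dc) /l mulr0 add0r; ring.
- rewrite (_ : partial i _ = fun x => partial i f x + partial i g x).
    exact: bumpD.
  apply/funext => x; rewrite /partial -deriveD//;
    by apply: diff_derivable; exact: differentiable_bump.
- rewrite (_ : partial i _ = fun x => f x * partial i g x + g x * partial i f x).
    by apply: bumpD; exact: bumpM.
  apply/funext => x; rewrite /partial; apply: deriveM;
    by apply: diff_derivable; exact: differentiable_bump.
Qed.

Lemma smooth_bump f : bump f -> smooth f.
Proof.
move=> bf l x; apply: differentiable_bump.
by elim: l => //= i l; exact: bump_partial.
Qed.

Lemma bump_prod (I : Type) (s : seq I) (F : I -> 'rV[R]_n -> R) :
  (forall i, bump (F i)) -> bump (fun x => \prod_(i <- s) F i x).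
Proof.
move=> bF; elim: s => [|i s IHs].
  by under eq_fun do rewrite big_nil; exact: bump_cst.
by under eq_fun do rewrite big_cons; exact: bumpM.
Qed.

Definition box_bump (a b : 'rV[R]_n) (m : nat) (x : 'rV[R]_n) : R :=
  \prod_i (flat 0 (m.+1%:R * (x ord0 i - a ord0 i)) *
           flat 0 (m.+1%:R * (b ord0 i - x ord0 i))).

Lemma bump_box_bump a b m : bump (box_bump a b m).
Proof.
apply: bump_prod => i; apply: bumpM.
  under eq_fun do rewrite mulrBr; exact: bump_flat.
under eq_fun => x.
  rewrite (_ : _ * _ = - m.+1%:R * x ord0 i + m.+1%:R * b ord0 i); last by ring.
  over.
exact: bump_flat.
Qed.

Lemma box_bump_ge0 a b m x : 0 <= box_bump a b m x.
Proof. by apply: prodr_ge0 => i _; rewrite mulr_ge0// flat_ge0. Qed.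

Lemma box_bump_le1 a b m x : box_bump a b m x <= 1.
Proof.
apply: prodr_ile1 => i _; rewrite mulr_ge0 ?flat_ge0//=.
by rewrite mulr_ile1 ?flat_ge0// flat0_le1.
Qed.

Lemma box_bump_out a b m x : ~ obox a b x -> box_bump a b m x = 0.
Proof.
move=> /existsNP[i /negP]; rewrite negb_and -!leNgt => h.
rewrite /box_bump (bigD1 i)//= [X in X * _](_ : _ = 0) ?mul0r//.
case/orP: h => h; [rewrite [flat 0 _]flat_le0 ?mul0r//|
  rewrite mulrC [flat 0 _]flat_le0 ?mul0r//];
  by rewrite mulr_ge0_le0// subr_le0.
Qed.

Lemma cvg_box_bump a b x :
  box_bump a b m x @[m --> \oo] --> (\1_(obox a b) x : R).
Proof.
rewrite indicE; have [xab|xab] := boolP (x \in obox a b); last first.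
  rewrite (_ : (fun m => _) = fun=> 0); first exact: cvg_cst.
  by apply/funext => m; rewrite box_bump_out// => /mem_set; exact/negP.
move/set_mem in xab.
rewrite [X in _ --> X](_ : _ = \prod_(i < n) (1 * 1)); last first.
  by rewrite mulr1 big1.
rewrite /box_bump; elim: (index_enum _) => [|i s IHs].
  under eq_fun do rewrite big_nil; rewrite big_nil; exact: cvg_cst.
under eq_fun do rewrite big_cons; rewrite big_cons.
have /andP[ai ib] := xab i.
by apply: cvgM => //; apply: cvgM; apply: cvg_flat0; rewrite subr_gt0.
Qed.

End bump_functions.

(** ** The fundamental lemma of the calculus of variations *)

Section orthants.
Context {R : realType} {n : nat}.
Implicit Types (a b c : 'rV[R]_n).

(** Orthants are stable under intersection, generate the Borel sets, and cut a box into a box again;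
    integrals over boxes therefore suffice to start a Dynkin argument. *)
Definition orthant c : set 'rV[R]_n := [set v | forall i, c ord0 i < v ord0 i].

Let orthants : set_system 'rV[R]_n := range orthant.

Lemma orthant_obox a b c :
  orthant c `&` obox a b = obox (\row_i Num.max (c ord0 i) (a ord0 i)) b.
Proof.
apply/seteqP; split => [v [cv av] i|v h].
  by rewrite mxE gt_max cv /=; exact: av.
by split => i; have := h i; rewrite mxE gt_max => /andP[/andP[? ?] ?] //; apply/andP.
Qed.

Lemma setI_closed_orthants : setI_closed orthants.
Proof.
move=> _ _ [a _ <-] [b _ <-].
exists (\row_i Num.max (a ord0 i) (b ord0 i)) => //.
apply/seteqP; split => [v h|v [av bv] i].
  by split => i; have := h i; rewrite mxE gt_max => /andP[].
by rewrite mxE gt_max av bv.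
Qed.


Lemma measurable_orthantsE : @measurable _ 'rV[R]_n = <<s orthants >>.
Proof.
apply/seteqP; split => [A mA|]; last first.
  apply: smallest_sub; first exact: sigma_algebra_measurable.
  move=> _ [c _ <-].
  rewrite (_ : orthant c = [set v | forall i, `]c ord0 i, +oo[%classic (v ord0 i)]).
    exact: (@measurable_prod_sets _ _ (fun i => `]c ord0 i, +oo[%classic)).
  by apply/seteqP; split => v /= h i; have := h i; rewrite in_itv/= andbT.
pose T := g_sigma_algebraType orthants.
have mid : measurable_fun [set: T] (id : T -> 'rV[R]_n).
  apply: measurable_fun_rVP => i.
  apply: (measurability _ (RGenOInfty.measurableE R)) => //.
  move=> _ [_ [x ->] <-]; rewrite setTI.
  (* The half-space v_i > x is the union over k of the orthants whose other corner coordinates are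
     -k. *)
  pose c k : 'rV[R]_n := \row_j if j == i then x else - k%:R.
  rewrite (_ : _ @^-1` _ = \bigcup_k (orthant (c k))).
    by apply: bigcupT_measurable => k; apply: sub_sigma_algebra; exists (c k).
  apply/seteqP; split => [v /=|v [k _ /(_ i)]].
    rewrite in_itv/= andbT => xv.
    exists (Num.truncn (\sum_j `|v ord0 j|)).+1 => // j; rewrite mxE.
    case: eqP => [->//|_]; rewrite ltrNl.
    rewrite (le_lt_trans (ler_norm _))// normrN (le_lt_trans _ (truncnS_gt _))//.
    by rewrite (bigD1 j)//= lerDl sumr_ge0.
  by rewrite mxE eqxx /= in_itv/= andbT.
by have := mid measurableT A mA; rewrite setTI.
Qed.

End orthants.

Section fundamental_lemma.
Context {R : realType} {n : nat}.
Variables (Omega : set 'rV[R]_n) (h : 'rV[R]_n -> R).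
Local Notation mu := (@lebesgue_rV R n).
Hypothesis oOmega : open Omega.
Hypothesis mh : measurable_fun Omega h.
Hypothesis ih : forall a b, cbox a b `<=` Omega ->
  mu.-integrable (obox a b) (EFin \o h).
Hypothesis h0 : forall psi, Cinfty_c Omega psi ->
  \int[mu]_(x in Omega) (h x * psi x) = 0.

Let mOmega : measurable Omega := open_measurable_rV oOmega.

Lemma Cinfty_c_box_bump a b m : cbox a b `<=` Omega ->
  Cinfty_c Omega (box_bump a b m).
Proof.
move=> abO; split; first exact/smooth_bump/bump_box_bump.
exists (cbox a b); split => //; first exact: compact_cbox.
by move=> x xab; apply: box_bump_out => /obox_sub_cbox.
Qed.

Lemma measurable_box_bump a b m : measurable_fun setT (box_bump a b m : 'rV[R]_n -> R).
Proof.
apply: continuous_measurable_rV => x; apply: differentiable_continuous.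
exact/differentiable_bump/bump_box_bump.
Qed.

Lemma integral_obox_eq0 a b : cbox a b `<=` Omega ->
  (\int[mu]_(x in obox a b) (h x)%:E = 0)%E.
Proof.
move=> abO; have mab := measurable_obox a b.
have abO' : obox a b `<=` Omega by exact: subset_trans (@obox_sub_cbox _ _ a b) abO.
have mhab : measurable_fun (obox a b) h by exact: measurable_funS mh.
have iab m : mu.-integrable (obox a b) (fun x => (h x * box_bump a b m x)%:E).
  apply: (le_integrable mab _ _ (ih abO)).
    apply/measurable_EFinP; apply: measurable_funM => //.
    by apply: measurable_funTS; exact: measurable_box_bump.
  move=> x _ /=; rewrite lee_fin normrM ler_piMr// ger0_norm ?box_bump_ge0//.
  exact: box_bump_le1.
have z m : (\int[mu]_(x in obox a b) (h x * box_bump a b m x)%:E = 0)%E.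
  (* The hypothesis [h0] concerns the real-valued integral, which is a [fine]; integrability is
     needed to lift it back to an extended real. *)
  rewrite -[LHS]fineK; last exact: integrable_fin_num.
  congr EFin; rewrite -[RHS](h0 (Cinfty_c_box_bump m abO)) /Rintegral; congr fine.
  rewrite -[in LHS](setIidr abO') integral_mkcondr.
  apply: eq_integral => x _; rewrite patchE; case: ifPn => // xab.
  by rewrite box_bump_out ?mulr0// => /mem_set; exact/negP.
have H : (\int[mu]_(x in obox a b) (h x * box_bump a b m x)%:E)%E @[m --> \oo] -->
    (\int[mu]_(x in obox a b) (h x)%:E)%E.
  apply: (@dominated_cvg _ _ _ mu _ mab _ _ (fun x => `|h x|%:E)) => //.
  - by move=> m; exact: measurable_int (iab m).
  - move=> x abx; apply: cvg_EFin; first exact: nearW.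
    rewrite -[X in _ --> X]mulr1; apply: cvgM; first exact: cvg_cst.
    by have := @cvg_box_bump _ _ a b x; rewrite indicE mem_set.
  - exact: integrable_abse (ih abO).
  - move=> m x _; rewrite lee_fin normrM ler_piMr// ger0_norm ?box_bump_ge0//.
    exact: box_bump_le1.
move: H; under eq_fun do rewrite z.
by move=> H; rewrite -(cvg_lim _ H)// lim_cst.
Qed.

(** The sets E for which h integrates to 0 over E within the box form a Dynkin system containing the
    orthants, hence all Borel sets. *)
Lemma ae_eq0_obox a b : cbox a b `<=` Omega ->
  ae_eq mu (obox a b) (EFin \o h) (cst 0%E).
Proof.
move=> abO; have mab := measurable_obox a b.
apply: integral_ae_eq => //; first exact: ih.
suff PE E : measurable E -> (\int[mu]_(x in E `&` obox a b) (h x)%:E = 0)%E.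
  by move=> E Eab mE; rewrite integral0 -[E](setIidl Eab); exact: PE.
rewrite [in X in X -> _]measurable_orthantsE => mE.
have iE (S : set 'rV[R]_n) : measurable S -> mu.-integrable (S `&` obox a b) (EFin \o h).
  move=> mS; apply: (integrableS mab) => //; last exact: ih.
  exact: measurableI.
pose P (S : set 'rV[R]_n) := (\int[mu]_(x in S `&` obox a b) (h x)%:E = 0)%E.
apply: (@dynkin_induction _ _ (range orthant) P) mE.
- exact: measurable_orthantsE.
- exact: setI_closed_orthants.
- by rewrite /P setTI; exact: integral_obox_eq0.
- move=> _ [c _ <-]; rewrite /P orthant_obox; apply: integral_obox_eq0.
  move=> v cv; apply: abO => i; have := cv i.
  by rewrite mxE ge_max => /andP[/andP[_ ->] ->].
- move=> S mS PS; have := integral_obox_eq0 abO.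
  rewrite -[X in (\int[mu]_(x in X) _)%E](setTI (obox a b)) -(setUv S) setIUl.
  rewrite integral_setU_EFin//.
  + by rewrite -/(P S) PS add0e.
  + exact: measurableI.
  + by apply: measurableI => //; exact: measurableC.
  + rewrite -setIUl setUv setTI; apply: measurable_funS mh => //.
    exact: subset_trans (@obox_sub_cbox _ _ a b) abO.
  + by rewrite disj_set2E setIACA setICr set0I.
- move=> F mF tF PF; rewrite /P setI_bigcupl integral_bigcup.
  + by apply: eseries0 => i _ _; exact: PF.
  + exact: trivIset_setIr.
  + by move=> k; exact: measurableI.
  + by rewrite -setI_bigcupl; apply: iE; exact: bigcupT_measurable.
Qed.

(** Countably many rational boxes with closure in [Omega] cover it, so their exceptional null sets
    can be merged. *)
Lemma Cinfty_c_ae_eq0 : \forall x \ae mu, Omega x -> h x = 0.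
Proof.
pose P p := cbox (rat_corner (-1) p) (rat_corner 1 p) `<=` Omega.
pose Q k x := if unpickle k is Some p then
  P p -> obox (rat_corner (-1) p) (rat_corner 1 p) x -> h x = 0 else True.
have : \forall x \ae mu, forall k, Q k x.
  apply: ae_foralln => k; rewrite /Q; case: unpickle => [p|]; last exact: aeW.
  have [Pp|nPp] := pselect (P p); last by apply: aeW => x /nPp.
  by have := ae_eq0_obox Pp; apply: filterS => x /= H _ /H [].
apply: filterS => x Qx Ox; have [p [xp pO]] := open_rat_box oOmega Ox.
by have := Qx (pickle p); rewrite /Q pickleK; exact.
Qed.

End fundamental_lemma.

(** ** Weighted spaces *)

Section real_integrable.
Context d (T : measurableType d) (R : realType).
Variables (mu : {measure set T -> \bar R}) (D : set T).
Hypothesis mD : measurable D.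
Implicit Types f g : T -> R.

Definition rint f := mu.-integrable D (EFin \o f).

Lemma rint_measurable f : rint f -> measurable_fun D f.
Proof. by move=> /measurable_int /measurable_EFinP. Qed.

Lemma ae_le_rint f g : measurable_fun D f -> rint g ->
  (\forall x \ae mu, D x -> `|f x| <= g x) -> rint f.
Proof.
move=> mf ig fg; apply/integrableP; split; first exact/measurable_EFinP.
have mg := rint_measurable ig.
case/integrableP: (ig) => _; apply: le_lt_trans; apply: ae_ge0_le_integral => //.
- by apply: measurableT_comp => //; exact/measurable_EFinP.
- by apply: measurableT_comp => //; exact/measurable_EFinP.
- apply: filterS fg => x /[swap] Dx /(_ Dx) fg.
  by rewrite lee_fin (le_trans fg)// ler_norm.
Qed.

Lemma rintD f g : rint f -> rint g -> rint (fun x => f x + g x).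
Proof. by move=> fi gi; exact: (integrableD mD fi gi). Qed.

Lemma rintB f g : rint f -> rint g -> rint (fun x => f x - g x).
Proof. by move=> fi gi; exact: (integrableB mD fi gi). Qed.

Lemma rintZ (a : R) f : rint f -> rint (fun x => a * f x).
Proof. by move=> fi; exact: (integrableZl mD a fi). Qed.

Lemma rint_norm f : rint f -> rint (fun x => `|f x|).
Proof. exact: integrable_abse. Qed.

Lemma ae_eq_Rintegral f g : measurable_fun D f -> measurable_fun D g ->
  (\forall x \ae mu, D x -> f x = g x) ->
  \int[mu]_(x in D) f x = \int[mu]_(x in D) g x.
Proof.
move=> mf mg fg; congr fine; apply: ae_eq_integral => //.
- exact/measurable_EFinP.
- exact/measurable_EFinP.
- by apply: filterS fg => x /[swap] Dx /(_ Dx) /= ->.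
Qed.

Lemma ae_le_Rintegral f g : rint f -> rint g ->
  (\forall x \ae mu, D x -> 0 <= f x <= g x) ->
  \int[mu]_(x in D) f x <= \int[mu]_(x in D) g x.
Proof.
move=> fi gi fg.
have mf := rint_measurable fi; have mg := rint_measurable gi.
have -> : \int[mu]_(x in D) f x = \int[mu]_(x in D) `|f x|.
  apply: ae_eq_Rintegral => //; first exact: measurableT_comp.
  by apply: filterS fg => x /[swap] Dx /(_ Dx) /andP[h _]; rewrite ger0_norm.
have -> : \int[mu]_(x in D) g x = \int[mu]_(x in D) `|g x|.
  apply: ae_eq_Rintegral => //; first exact: measurableT_comp.
  apply: filterS fg => x /[swap] Dx /(_ Dx) /andP[h1 h2].
  by rewrite ger0_norm// (le_trans h1).
rewrite fine_le//; [exact/integrable_fin_num/rint_norm.. |].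
apply: ae_ge0_le_integral => //.
- by apply/measurable_EFinP; exact: measurableT_comp.
- by apply/measurable_EFinP; exact: measurableT_comp.
- apply: filterS fg => x /[swap] Dx /(_ Dx) /andP[h1 h2].
  by rewrite lee_fin !ger0_norm// (le_trans h1).
Qed.

End real_integrable.

Section weighted_spaces.
Context {R : realType} {n : nat}.
Variables (Omega : set 'rV[R]_n) (w : 'rV[R]_n -> R) (W : R).
Local Notation mu := (@lebesgue_rV R n).
Local Notation ri := (rint mu Omega).
Hypothesis mO : measurable Omega.
Hypothesis finO : (mu Omega < +oo)%E.
Hypothesis mw : measurable_fun Omega w.
Hypothesis w_gt0 : forall x, Omega x -> 0 < w x.
Hypothesis w_le : forall x, Omega x -> w x <= W.
Implicit Types f g psi : 'rV[R]_n -> R.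

Lemma rint_cst (c : R) : ri (fun=> c).
Proof.
apply: measurable_bounded_integrable => //.
by exists `|c|; split; [exact: num_real|move=> x /ltW h y _ /=].
Qed.

Lemma ae_bounded_rint f (M : R) : measurable_fun Omega f ->
  (\forall x \ae mu, Omega x -> `|f x| <= M) -> ri f.
Proof. by move=> mf; exact: (ae_le_rint mO mf (rint_cst M)). Qed.

Lemma wLinftyP psi : wLinfty Omega w psi <-> measurable_fun Omega psi /\
  exists2 M, 0 <= M & \forall x \ae mu, Omega x -> `|psi x| <= M * w x.
Proof.
split=> [[mpsi [_ [M HM]]]|[mpsi [M M0 HM]]]; split => //.
  exists (Num.max M 0); first by rewrite le_max lexx orbT.
  apply: filterS HM => x /[swap] Ox /(_ Ox).
  rewrite normrM normfV (gtr0_norm (w_gt0 Ox)) ler_pdivrMr ?w_gt0// => h.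
  by rewrite (le_trans h)// ler_wpM2r ?(ltW (w_gt0 Ox))// le_max lexx.
split.
  apply: (eq_measurable_fun (fun x => psi x * w x `^ (-1))).
    by move=> x /set_mem Ox; rewrite powR_inv1// ltW// w_gt0.
  by apply: measurable_funM => //; exact: (measurableT_comp (measurable_powR _)).
exists M; apply: filterS HM => x /[swap] Ox /(_ Ox) h.
by rewrite normrM normfV (gtr0_norm (w_gt0 Ox)) ler_pdivrMr ?w_gt0.
Qed.

Lemma wLinfty_Linfty psi : wLinfty Omega w psi -> Linfty Omega psi.
Proof.
move=> /wLinftyP[mpsi [M M0 HM]]; split => //; exists (M * W).
apply: filterS HM => x /[swap] Ox /(_ Ox) h.
by rewrite (le_trans h)// ler_wpM2l// w_le.
Qed.

Lemma Linfty_L1w f : Linfty Omega f -> L1w Omega w f.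
Proof.
move=> [mf [M HM]]; split => //.
apply: (@ae_bounded_rint _ (M * W)); first exact: measurable_funM.
apply: filterS HM => x /[swap] Ox /(_ Ox) h.
by rewrite normrM ler_pM// (gtr0_norm (w_gt0 Ox)) w_le.
Qed.

Lemma Linfty_L2 f : Linfty Omega f -> L2 Omega f.
Proof.
move=> [mf [M HM]]; split => //.
apply: (@ae_bounded_rint _ (M ^+ 2)); first exact: measurable_funX.
apply: filterS HM => x /[swap] Ox /(_ Ox) h.
by rewrite normrX ler_pXn2r// nnegrE (le_trans _ h).
Qed.

Lemma L1wD f g : L1w Omega w f -> L1w Omega w g -> L1w Omega w (fun x => f x + g x).
Proof.
move=> [mf fi] [mg gi]; split; first exact: measurable_funD.
by under eq_fun do rewrite mulrDl; exact: rintD.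
Qed.

Lemma L1wZ a f : L1w Omega w f -> L1w Omega w (fun x => a * f x).
Proof.
move=> [mf fi]; split; first exact: measurable_funM.
by under eq_fun do rewrite -mulrA; exact: rintZ.
Qed.

Lemma L1wB f g : L1w Omega w f -> L1w Omega w g -> L1w Omega w (fun x => f x - g x).
Proof.
move=> [mf fi] [mg gi]; split; first exact: measurable_funB.
by under eq_fun do rewrite mulrBl; exact: rintB.
Qed.

Lemma wLinftyD f g : wLinfty Omega w f -> wLinfty Omega w g ->
  wLinfty Omega w (fun x => f x + g x).
Proof.
move=> /wLinftyP[mf [M M0 HM]] /wLinftyP[mg [N N0 HN]]; apply/wLinftyP; split.
  exact: measurable_funD.
exists (M + N); first exact: addr_ge0.
apply: filterS2 HM HN => x HM HN Ox.
by rewrite mulrDl (le_trans (ler_normD _ _))// lerD ?HM ?HN.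
Qed.

Lemma wLinftyZ a f : wLinfty Omega w f -> wLinfty Omega w (fun x => a * f x).
Proof.
move=> /wLinftyP[mf [M M0 HM]]; apply/wLinftyP; split; first exact: measurable_funM.
exists (`|a| * M); first exact: mulr_ge0.
by apply: filterS HM => x HM Ox; rewrite normrM -mulrA ler_wpM2l// HM.
Qed.

Lemma wLinftyB f g : wLinfty Omega w f -> wLinfty Omega w g ->
  wLinfty Omega w (fun x => f x - g x).
Proof.
move=> wf wg; have := wLinftyD wf (wLinftyZ (-1) wg).
by under eq_fun do rewrite mulN1r.
Qed.

Lemma L1w_wLinfty_rint f psi : L1w Omega w f -> wLinfty Omega w psi ->
  ri (fun x => f x * psi x).
Proof.
move=> [mf fi] /wLinftyP[mpsi [M M0 HM]].
apply: (ae_le_rint mO _ (rintZ mO M (rint_norm fi))).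
  exact: measurable_funM.
apply: filterS HM => x HM Ox; rewrite !normrM (gtr0_norm (w_gt0 Ox)) mulrCA.
by rewrite ler_wpM2l// HM.
Qed.

Definition L1w_rnorm f : R := \int[mu]_(x in Omega) `|f x * w x|.

Lemma L1w_normE f : L1w Omega w f -> L1w_norm Omega w f = (L1w_rnorm f)%:E.
Proof.
by move=> [mf fi]; rewrite /L1w_rnorm fineK//; exact/integrable_fin_num/rint_norm.
Qed.

Lemma pairing_le_rnorm f psi M : L1w Omega w f -> measurable_fun Omega psi ->
  0 <= M -> (\forall x \ae mu, Omega x -> `|psi x| <= M * w x) ->
  `|\int[mu]_(x in Omega) (f x * psi x)| <= M * L1w_rnorm f.
Proof.
move=> fw mpsi M0 HM.
have wpsi : wLinfty Omega w psi by apply/wLinftyP; split => //; exists M.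
have ip := L1w_wLinfty_rint fw wpsi; have [mf fi] := fw.
rewrite (le_trans (le_normr_Rintegral mO ip))//.
have fi' := rint_norm fi.
rewrite /L1w_rnorm -RintegralZl//; apply: ae_le_Rintegral => //.
- exact: rint_norm.
- exact: rintZ.
apply: filterS HM => x HM Ox; rewrite normr_ge0/= !normrM (gtr0_norm (w_gt0 Ox)) mulrCA.
by rewrite ler_wpM2l// HM.
Qed.

(** The truncation to {|f| <= k} agrees with f at x once k >= |f x|, and its error is at most |f|:
    dominated convergence applies. *)
Lemma Linfty_dense f (e : R) : L1w Omega w f -> 0 < e ->
  exists g, Linfty Omega g /\ L1w_rnorm (fun x => g x - f x) < e.
Proof.
move=> [mf fi] e0.
pose g k x := if `|f x| <= k%:R then f x else 0 : R.
have mg k : measurable_fun Omega (g k).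
  apply: measurable_fun_if => //.
    by apply: measurable_fun_ler => //; exact: measurableT_comp.
  by apply: measurable_funS mf => // x [].
have gL k : Linfty Omega (g k).
  split => //; exists k%:R; apply: aeW => x _; rewrite /g.
  by case: ifP => //; rewrite normr0.
have H : (\int[mu]_(x in Omega) `|(g k x - f x) * w x|%:E)%E @[k --> \oo] -->
    (\int[mu]_(x in Omega) 0)%E.
  apply: (@dominated_cvg _ _ _ mu _ mO _ _ (fun x => `|f x * w x|%:E)) => //.
  - move=> k; apply/measurable_EFinP; apply: measurableT_comp => //.
    by apply: measurable_funM => //; exact: measurable_funB.
  - move=> x Ox; apply: cvg_near_cst; exists (Num.truncn `|f x|).+1 => // k /= kx.
    rewrite /g ifT ?subrr ?mul0r ?normr0//.
    by rewrite (le_trans (ltW (truncnS_gt _)))// ler_nat.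
  - exact: rint_norm.
  - move=> k x Ox; rewrite lee_fin normr_id !normrM ler_wpM2r//.
    by rewrite /g; case: ifP => _; rewrite ?subrr ?normr0// sub0r normrN.
rewrite integral0 in H.
have n0 : nbhs (0%E : \bar R) [set y | (y < e%:E)%E].
  by apply: open_nbhs_nbhs; split; [exact: open_ereal_lt_ereal|rewrite /= lte_fin].
have [N _ HN] := H _ n0.
exists (g N); split => //; rewrite -lte_fin.
have := HN N (leqnn N); rewrite /= -L1w_normE//.
by apply: L1wB => //; exact: Linfty_L1w.
Qed.

Lemma L2_mul_rint f g : L2 Omega f -> L2 Omega g -> ri (fun x => f x * g x).
Proof.
move=> [mf fi] [mg gi].
apply: (ae_le_rint mO _ (rintD mO fi gi)); first exact: measurable_funM.
apply: aeW => x _; rewrite normrM -(real_normK (num_real (f x))).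
rewrite -(real_normK (num_real (g x))).
by move: (normr_ge0 (f x)) (normr_ge0 (g x)); move: `|f x| `|g x| => a b; nra.
Qed.

Lemma L2Z a f : L2 Omega f -> L2 Omega (fun x => a * f x).
Proof.
move=> [mf fi]; split; first exact: measurable_funM.
by under eq_fun do rewrite exprMn; exact: rintZ.
Qed.

Lemma L2D f g : L2 Omega f -> L2 Omega g -> L2 Omega (fun x => f x + g x).
Proof.
move=> fL gL; have [mf fi] := fL; have [mg gi] := gL; split.
  exact: measurable_funD.
rewrite (_ : (fun x => _) = EFin \o (fun x => (f x ^+ 2 + g x ^+ 2) + 2 * (f x * g x))).
  by apply: rintD => //; [exact: rintD|apply: rintZ => //; exact: L2_mul_rint].
by apply/funext => x /=; congr EFin; ring.
Qed.

Lemma L2B f g : L2 Omega f -> L2 Omega g -> L2 Omega (fun x => f x - g x).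
Proof.
move=> fL /(L2Z (-1)) gL; have := L2D fL gL.
by under eq_fun do rewrite mulN1r.
Qed.

Lemma L2_0 : L2 Omega (fun=> 0 : R).
Proof.
by apply: Linfty_L2; split => //; exists 0; apply: aeW => x _; rewrite normr0.
Qed.

(** * Series in L^2 and their pairings *)

Section L2_sums.
Variable phi : nat -> 'rV[R]_n -> R.
Hypothesis phi_L2 : forall j, L2 Omega (phi j).
Implicit Type c : nat -> R.

Let S c N x := \sum_(j < N) c j * phi j x.

Lemma L2_partial_sum c N : L2 Omega (S c N).
Proof.
rewrite /S; elim: N => [|N IHN].
  by under eq_fun do rewrite big_ord0; exact: L2_0.
by under eq_fun do rewrite big_ord_recr/=; apply: L2D => //; exact: L2Z.
Qed.

Lemma pairing_partial_sum c N psi : L2 Omega psi ->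
  \int[mu]_(x in Omega) (S c N x * psi x) = \sum_(j < N) c j * pairing Omega (phi j) psi.
Proof.
move=> psiL; rewrite /S; elim: N => [|N IHN].
  under eq_Rintegral do rewrite big_ord0 mul0r.
  by rewrite big_ord0 Rintegral_cst// mul0r.
under eq_Rintegral do rewrite big_ord_recr/= mulrDl -mulrA.
rewrite RintegralD// ?RintegralZl// ?IHN ?big_ord_recr//.
- exact: L2_mul_rint.
- exact: (L2_mul_rint (L2_partial_sum c N)).
- by apply: (rintZ mO); exact: L2_mul_rint.
Qed.

Lemma L2_sum_rcvg c g : L2_sum Omega c phi g ->
  \int[mu]_(x in Omega) (g x - S c N x) ^+ 2 @[N --> \oo] --> (0 : R).
Proof. by move=> [gL /fine_cvg]. Qed.

Lemma L2_sum_pairing c g psi : L2_sum Omega c phi g -> L2 Omega psi ->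
  \sum_(j < N) c j * pairing Omega (phi j) psi @[N --> \oo] --> pairing Omega g psi.
Proof.
move=> gS psiL; have gL := gS.1.
under eq_fun do rewrite -(pairing_partial_sum _ _ psiL).
pose P := \int[mu]_(x in Omega) psi x ^+ 2.
have P0 : 0 <= P by apply: Rintegral_ge0 => x _; exact: sqr_ge0.
apply/cvgrPdist_le => e e0.
(* Young's inequality |ab| <= a^2/(2d) + d b^2/2 stands in for Cauchy-Schwarz. This d gives d P <=
   e, and the squared tail Q is taken at most e d, so each term is at most e/2. *)
pose d := e / (P + 1); have d0 : 0 < d by rewrite divr_gt0// ltr_wpDl.
have /cvgrPdist_le/(_ (e * d)) := L2_sum_rcvg gS.
rewrite mulr_gt0// => /(_ erefl); apply: filterS => N.
set Q := Rintegral _ _ _; rewrite sub0r normrN => HQ.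
have gSL := L2B gL (L2_partial_sum c N).
rewrite -RintegralB//; [|exact: L2_mul_rint|exact: (L2_mul_rint (L2_partial_sum c N))].
under eq_Rintegral do rewrite -mulrBl.
have i1 := L2_mul_rint gSL psiL.
rewrite (le_trans (le_normr_Rintegral mO i1))//.
have i2 : ri (fun x => (2 * d)^-1 * (g x - S c N x) ^+ 2 + d / 2 * psi x ^+ 2).
  by apply: rintD => //; apply: rintZ => //; [exact: gSL.2|exact: psiL.2].
apply: (@le_trans _ _ (\int[mu]_(x in Omega)
   ((2 * d)^-1 * (g x - S c N x) ^+ 2 + d / 2 * psi x ^+ 2))).
  apply: ae_le_Rintegral => //; first exact: rint_norm.
  apply: aeW => x _; rewrite normr_ge0 /= normrM -real_normK ?num_real//.
  rewrite -[psi x ^+ 2]real_normK ?num_real// -subr_ge0.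
  rewrite (_ : _ - _ = (2 * d)^-1 * (`|g x - S c N x| - d * `|psi x|) ^+ 2).
    by rewrite mulr_ge0 ?sqr_ge0// invr_ge0 mulr_ge0// ltW.
  by field; rewrite gt_eqF.
rewrite RintegralD//; [|exact/(rintZ mO)/gSL.2|exact/(rintZ mO)/psiL.2].
rewrite RintegralZl//; last exact: gSL.2.
rewrite RintegralZl//; last exact: psiL.2.
rewrite -/Q -/P.
have h1 : (2 * d)^-1 * Q <= e / 2.
  rewrite invfM mulrC -ler_pdivlMr ?mulr_gt0 ?invr_gt0//.
  by rewrite invfM !invrK (le_trans (ler_norm Q))// (le_trans HQ)//; nra.
have h2 : d / 2 * P <= e / 2.
  have : d * P <= e by rewrite /d mulrAC ler_pdivrMr ?ltr_wpDl// ler_wpM2l ?(ltW e0)// lerDl.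
  lra.
lra.
Qed.

(** Pairing g and h with g - h gives limits of the same sequence, so the square of g - h has
    integral 0. *)
Lemma L2_sum_unique c g h : L2_sum Omega c phi g -> L2_sum Omega c phi h ->
  \forall x \ae mu, Omega x -> g x = h x.
Proof.
move=> gS hS; have gL := gS.1; have hL := hS.1; have ghL := L2B gL hL.
have e0 : pairing Omega (fun x => g x - h x) (fun x => g x - h x) = 0.
  have /cvg_unique := L2_sum_pairing gS ghL.
  move=> /(_ (@norm_hausdorff _ _) _ (L2_sum_pairing hS ghL)) E.
  rewrite /pairing; under eq_Rintegral do rewrite mulrBl.
  by rewrite RintegralB ?[X in X - _]E ?subrr//; exact: L2_mul_rint.
have : (\int[mu]_(x in Omega) `|((g x - h x) * (g x - h x))%:E| = 0)%E.
  rewrite -[LHS]fineK; last exact/integrable_fin_num/rint_norm/L2_mul_rint.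
  rewrite -[RHS]/(0%:E) -[in RHS]e0; congr EFin; congr fine.
  by apply: eq_integral => x _; rewrite abse_EFin ger0_norm// -expr2 sqr_ge0.
move=> /ae_eq_integral_abs H; have {}H := H mO _.
have : ae_eq mu Omega (fun x => ((g x - h x) * (g x - h x))%:E) (cst 0%E).
  by apply: H; apply: measurable_int (L2_mul_rint ghL ghL).
apply: filterS => x /[swap] Ox /(_ Ox) [] /eqP.
by rewrite mulf_eq0 orbb subr_eq0 => /eqP.
Qed.

End L2_sums.

End weighted_spaces.

(** ** Symmetric kernel operators *)

Section kernel_operator.
Context {R : realType} {n : nat}.
Variables (Omega : set 'rV[R]_n) (w : 'rV[R]_n -> R) (W C : R).
Variable K : 'rV[R]_n -> 'rV[R]_n -> R.
Local Notation mu := (@lebesgue_rV R n).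
Local Notation ri := (rint mu Omega).
Hypothesis mO : measurable Omega.
Hypothesis finO : (mu Omega < +oo)%E.
Hypothesis mw : measurable_fun Omega w.
Hypothesis w_gt0 : forall x, Omega x -> 0 < w x.
Hypothesis w_le : forall x, Omega x -> w x <= W.
Hypothesis mK : measurable_fun setT (fun z : 'rV[R]_n * 'rV[R]_n => K z.1 z.2).
Hypothesis K_ge0 : forall x y, 0 <= K x y.
Hypothesis K_sym : forall x y, K x y = K y x.
Hypothesis C_ge0 : 0 <= C.
Hypothesis K_le : forall x, Omega x ->
  (\int[mu]_(y in Omega) (K x y * w y)%:E <= (C * w x)%:E)%E.
Implicit Types f g psi : 'rV[R]_n -> R.

Definition kernel_op f x : R := \int[mu]_(y in Omega) (K x y * f y).

(** Fubini and Tonelli are applied on the whole product space, so functions on [Omega] are extended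
    by 0. *)
Let ext f : 'rV[R]_n -> R := f \_ Omega.

Let extE f x : Omega x -> ext f x = f x.
Proof. by move=> Ox; rewrite /ext patchE mem_set. Qed.

Let ext_out f x : ~ Omega x -> ext f x = 0.
Proof. by move=> Ox; rewrite /ext patchE memNset. Qed.

Let measurable_ext f : measurable_fun Omega f -> measurable_fun setT (ext f).
Proof. by move=> mf; apply/(measurable_restrictT _ mO). Qed.

Let integral_ext (F : 'rV[R]_n -> R) f :
  (\int[mu]_(y in Omega) (F y * f y)%:E = \int[mu]_y (F y * ext f y)%:E)%E.
Proof.
rewrite integral_mkcond; apply: eq_integral => y _; rewrite patchE.
by case: ifPn => [/set_mem Oy|/negP Oy]; [rewrite extE|rewrite ext_out ?mulr0//; move/mem_set].
Qed.

Let H f psi (z : 'rV[R]_n * 'rV[R]_n) : R := K z.1 z.2 * ext f z.2 * ext psi z.1.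

Let measurable_H f psi : measurable_fun Omega f -> measurable_fun Omega psi ->
  measurable_fun setT (H f psi).
Proof.
move=> mf mpsi; apply: measurable_funM; first apply: measurable_funM => //.
- exact: (measurableT_comp (measurable_ext mf) measurable_snd).
- exact: (measurableT_comp (measurable_ext mpsi) measurable_fst).
Qed.

Let measurable_K1 x : measurable_fun setT (K x).
Proof. exact: (measurableT_comp mK (pair1_measurable x)). Qed.

(** Positive and negative parts of the integrand are treated separately by Tonelli, so that f may be
    merely measurable and the integral may diverge at some x. *)
Lemma measurable_kernel_op f : measurable_fun Omega f ->
  measurable_fun Omega (kernel_op f).
Proof.
move=> mf; apply: measurable_funTS.
pose h (z : 'rV[R]_n * 'rV[R]_n) := (K z.1 z.2 * ext f z.2)%:E.
have mh : measurable_fun setT h.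
  apply/measurable_EFinP; apply: measurable_funM => //.
  exact: (measurableT_comp (measurable_ext mf) measurable_snd).
apply: (measurableT_comp (fine_measurable measurableT)).
rewrite (_ : (fun x => _) = (fun x => \int[mu]_y h^\+ (x, y) - \int[mu]_y h^\- (x, y))%E).
  apply: emeasurable_funB.
    apply: (measurable_fun_fubini_tonelli_F (m2 := mu)) => //.
    exact: measurable_funepos.
  apply: (measurable_fun_fubini_tonelli_F (m2 := mu)) => //.
  exact: measurable_funeneg.
apply/funext => x; rewrite (integral_ext (K x)) integralE.
by congr (_ - _)%E; apply: eq_integral => y _; rewrite ?funeposE ?funenegE.
Qed.

(** A Schur test with weight w. It holds at every x of [Omega]: images of test functions are given
    by convergent integrals everywhere, those of L^1(w) functions only almost everywhere. *)
Lemma kernel_op_ge0_le psi M x : measurable_fun Omega psi -> 0 <= M -> Omega x ->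
  (\forall y \ae mu, Omega y -> `|psi y| <= M * w y) ->
  (\int[mu]_(y in Omega) `|K x y * psi y|%:E <= (M * C * w x)%:E)%E.
Proof.
move=> mpsi M0 Ox HM.
apply: (@le_trans _ _ (\int[mu]_(y in Omega) (M%:E * (K x y * w y)%:E))%E).
  apply: ae_ge0_le_integral => //.
  - apply/measurable_EFinP; apply: measurableT_comp => //.
    by apply: measurable_funM => //; apply: measurable_funTS.
  - by move=> y Oy; rewrite lee_fin !mulr_ge0// ltW// w_gt0.
  - apply/measurable_EFinP; apply: measurable_funM => //.
    by apply: measurable_funM => //; apply: measurable_funTS.
  - apply: filterS HM => y HM Oy; rewrite lee_fin normrM ger0_norm// mulrCA.
    by rewrite ler_wpM2l// HM.
rewrite ge0_integralZl_EFin//.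
- by rewrite -mulrA EFinM lee_wpmul2l// K_le.
- by move=> y Oy; rewrite lee_fin mulr_ge0// ltW// w_gt0.
- apply/measurable_EFinP; apply: measurable_funM => //.
  by apply: measurable_funTS.
Qed.

Lemma kernel_rint psi x : wLinfty Omega w psi -> Omega x ->
  ri (fun y => K x y * psi y).
Proof.
move=> /(wLinftyP mw w_gt0)[mpsi [M M0 HM]] Ox; apply/integrableP; split.
  apply/measurable_EFinP; apply: measurable_funM => //.
  by apply: measurable_funTS.
exact: le_lt_trans (kernel_op_ge0_le mpsi M0 Ox HM) (ltry _).
Qed.

Lemma wLinfty_kernel_op psi : wLinfty Omega w psi ->
  wLinfty Omega w (kernel_op psi).
Proof.
move=> wpsi; have /(wLinftyP mw w_gt0)[mpsi [M M0 HM]] := wpsi.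
apply/(wLinftyP mw w_gt0); split; first exact: measurable_kernel_op.
exists (M * C); first exact: mulr_ge0.
apply: aeW => x Ox; have i := kernel_rint wpsi Ox.
rewrite (le_trans (le_normr_Rintegral mO i))// -lee_fin fineK.
  exact: kernel_op_ge0_le.
exact/integrable_fin_num/rint_norm.
Qed.

(** Integrating in x first, symmetry of the kernel and the Schur bound give at most M C w(y) |f(y)|,
    which is integrable since f is in L^1(w). *)
Lemma integrable_H f psi : L1w Omega w f -> wLinfty Omega w psi ->
  (mu \x mu)%E.-integrable setT (EFin \o H f psi).
Proof.
move=> fw /(wLinftyP mw w_gt0)[mpsi [M M0 HM]]; have [mf fi] := fw.
apply/integrable21ltyP; first by apply/measurable_EFinP; exact: measurable_H.
apply: (@le_lt_trans _ _ (\int[mu]_(y in Omega) ((M * C)%:E * `|f y * w y|%:E))%E).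
  rewrite [leRHS]integral_mkcond; apply: ge0_le_integral => //.
  - by move=> y _; apply: integral_ge0.
  - apply: (measurable_fun_fubini_tonelli_G (m1 := mu) (fun z => `|(H f psi z)%:E|%E)) => //.
    by apply/measurable_EFinP; apply: measurableT_comp => //; exact: measurable_H.
  - apply/(measurable_restrictT _ mO); apply/measurable_EFinP.
    apply: measurable_funM => //; apply: measurableT_comp => //.
    exact: measurable_funM.
  move=> y _; rewrite patchE; case: ifPn => [/set_mem Oy|/negP nOy]; last first.
    rewrite integral0_eq// => x _; rewrite /H/= ext_out ?mulr0 ?mul0r ?normr0//.
    by move/mem_set.
  rewrite (_ : (\int[mu]_x _)%E =
      (`|f y|%:E * \int[mu]_(x in Omega) `|K y x * psi x|%:E)%E); last first.
    rewrite -ge0_integralZl_EFin//; last first.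
      apply/measurable_EFinP; apply: measurableT_comp => //.
      by apply: measurable_funM => //; apply: measurable_funTS.
    rewrite [RHS]integral_mkcond; apply: eq_integral => x _; rewrite patchE.
    case: ifPn => [/set_mem Ox|/negP nOx]; last first.
      by rewrite /H/= (ext_out psi) ?mulr0 ?normr0// => /mem_set.
    rewrite /H/= !extE// -EFinM -normrM K_sym; congr (`|_|%:E); ring.
  rewrite normrM (gtr0_norm (w_gt0 Oy)) -EFinM (_ : M * C * _ = `|f y| * (M * C * w y)).
    by rewrite [leRHS]EFinM lee_wpmul2l ?lee_fin//; exact: kernel_op_ge0_le.
  ring.
rewrite ge0_integralZl_EFin ?mulr_ge0//.
  have /integrableP[_] := rint_norm fi; rewrite (_ : (fun x => _) = fun x => `|f x * w x|%:E).
    by move=> h; rewrite lte_mul_pinfty ?lee_fin ?mulr_ge0.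
  by apply/funext => x /=; rewrite normr_id.
by apply/measurable_EFinP; apply: measurableT_comp => //; exact: measurable_funM.
Qed.

Lemma wLinfty_w : wLinfty Omega w w.
Proof.
apply/(wLinftyP mw w_gt0); split => //; exists 1 => //.
by apply: aeW => x Ox; rewrite mul1r gtr0_norm// w_gt0.
Qed.

(** Fubini with psi = w makes the integrand times w(x) integrable in y for almost every x; the
    factor w(x) > 0 is then divided out. *)
Lemma ae_kernel_rint f : L1w Omega w f ->
  \forall x \ae mu, Omega x -> ri (fun y => K x y * f y).
Proof.
move=> fw; have [mf _] := fw.
have := ae_integrable1 (integrable_H fw wLinfty_w).
apply: filterS => x /= ix Ox.
have /(integrableZl mO (w x)^-1) := integrableS measurableT mO (@subsetT _ _) ix.
apply: eq_integrable => // y /set_mem Oy /=.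
rewrite /H/= !extE// -EFinM; congr EFin; field.
by rewrite gt_eqF// w_gt0.
Qed.

Lemma integral_H1 f psi x : Omega x -> ri (fun y => K x y * f y) ->
  (\int[mu]_y (H f psi (x, y))%:E = (kernel_op f x * psi x)%:E)%E.
Proof.
move=> Ox ix.
transitivity (\int[mu]_(y in Omega) (K x y * psi x * f y)%:E)%E.
  rewrite integral_ext; apply: eq_integral => y _.
  by rewrite /H/= (extE psi Ox); congr EFin; ring.
rewrite /kernel_op -RintegralZr// fineK; last first.
  apply: integrable_fin_num => //; under eq_fun do rewrite mulrC.
  exact: rintZ.
by apply: eq_integral => y _; congr EFin; ring.
Qed.

Lemma integral_H2 f psi y : Omega y -> wLinfty Omega w psi ->
  (\int[mu]_x (H f psi (x, y))%:E = (f y * kernel_op psi y)%:E)%E.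
Proof.
move=> Oy wpsi; have iy := kernel_rint wpsi Oy.
transitivity (\int[mu]_(x in Omega) (K x y * f y * psi x)%:E)%E.
  rewrite integral_ext; apply: eq_integral => x _.
  by rewrite /H/= (extE f Oy); congr EFin; ring.
rewrite /kernel_op -RintegralZl// fineK; last first.
  by apply: integrable_fin_num => //; exact: rintZ.
by apply: eq_integral => x _; rewrite K_sym; congr EFin; ring.
Qed.

Lemma ae_fubini_H f psi : L1w Omega w f -> wLinfty Omega w psi ->
  \forall x \ae mu, Omega x ->
    (\int[mu]_y (H f psi (x, y))%:E = (kernel_op f x * psi x)%:E)%E.
Proof.
move=> fw wpsi; apply: filterS (ae_kernel_rint fw) => x ix Ox.
by rewrite integral_H1//; exact: ix.
Qed.

Lemma kernel_op_symmetric f psi : L1w Omega w f -> wLinfty Omega w psi ->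
  \int[mu]_(x in Omega) (kernel_op f x * psi x) =
  \int[mu]_(x in Omega) (f x * kernel_op psi x).
Proof.
move=> fw wpsi; have [mf _] := fw; have [mpsi _] := wpsi.
have iH := integrable_H fw wpsi.
rewrite /Rintegral; congr fine.
transitivity (\int[mu]_x \int[mu]_y (H f psi (x, y))%:E)%E.
  rewrite integral_mkcond; apply: ae_eq_integral => //.
  - apply/(measurable_restrictT _ mO)/measurable_EFinP; apply: measurable_funM => //.
    exact: measurable_kernel_op.
  - exact: (measurable_fubini_F iH).
  apply: filterS (ae_fubini_H fw wpsi) => x hx _; rewrite patchE.
  case: ifPn => [/set_mem Ox|/negP Ox]; first by rewrite hx.
  by rewrite integral0_eq// => y _; rewrite /H/= (ext_out psi) ?mulr0// => /mem_set.
transitivity (\int[mu]_y \int[mu]_x (H f psi (x, y))%:E)%E.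
  have := integral12_prod_meas1 iH; rewrite /fubini_F/= => ->.
  by have := integral21_prod_meas1 iH; rewrite /fubini_G/= => ->.
rewrite [RHS]integral_mkcond; apply: eq_integral => y _; rewrite patchE.
case: ifPn => [/set_mem Oy|/negP Oy]; first by rewrite integral_H2.
by rewrite integral0_eq// => x _; rewrite /H/= (ext_out f) ?mulr0 ?mul0r// => /mem_set.
Qed.

(** With psi = w the inner integral of [H] is almost everywhere the image of f times w, and Fubini
    makes it integrable. *)
Lemma L1w_kernel_op f : L1w Omega w f -> L1w Omega w (kernel_op f).
Proof.
move=> fw; have [mf _] := fw.
have iH := integrable_H fw wLinfty_w.
have mk := measurable_kernel_op mf.
split => //; apply/integrableP; split.
  by apply/measurable_EFinP; exact: measurable_funM.
have iF := integrable_fubini_F iH.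
have /integrableP[mF] := integrableS measurableT mO (@subsetT _ _) iF.
apply: le_lt_trans; apply: ae_ge0_le_integral => //.
- by apply: measurableT_comp => //; apply/measurable_EFinP; exact: measurable_funM.
- exact: measurableT_comp.
- apply: filterS (ae_fubini_H fw wLinfty_w) => x hx Ox.
  by rewrite /fubini_F/= hx.
Qed.

End kernel_operator.

(** ** Operators diagonal in an orthonormal family *)

Section diagonal_operator.
Context {R : realType} {n : nat}.
Variables (Omega : set 'rV[R]_n) (w : 'rV[R]_n -> R) (W : R).
Variables (phi : nat -> 'rV[R]_n -> R) (a : nat -> R).
Variable T : ('rV[R]_n -> R) -> 'rV[R]_n -> R.
Local Notation mu := (@lebesgue_rV R n).
Local Notation ri := (rint mu Omega).
Hypothesis mO : measurable Omega.
Hypothesis finO : (mu Omega < +oo)%E.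
Hypothesis mw : measurable_fun Omega w.
Hypothesis w_gt0 : forall x, Omega x -> 0 < w x.
Hypothesis w_le : forall x, Omega x -> w x <= W.
Hypothesis phi_L2 : forall j, L2 Omega (phi j).
Hypothesis T_cont : L1w_continuous Omega w T.
Hypothesis T_sum : forall f, L2 Omega f ->
  L2_sum Omega (fun j => pairing Omega f (phi j) * a j) phi (T f).
Implicit Types f g psi : 'rV[R]_n -> R.

Lemma pairingC f g : pairing Omega f g = pairing Omega g f.
Proof. by apply: eq_Rintegral => x _; rewrite mulrC. Qed.

(** Both pairings are the limit of the partial sums of a_j times the j-th coefficients of f and g,
    an expression symmetric in f and g. *)
Lemma diagonal_symmetric_L2 f g : L2 Omega f -> L2 Omega g ->
  pairing Omega (T f) g = pairing Omega f (T g).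
Proof.
move=> fL gL; rewrite [RHS]pairingC.
have F := L2_sum_pairing mO finO phi_L2 (T_sum fL) gL.
have G := L2_sum_pairing mO finO phi_L2 (T_sum gL) fL.
apply: (cvg_unique (@norm_hausdorff _ _) F).
rewrite (_ : (fun N => _) = (fun N =>
  \sum_(j < N) pairing Omega g (phi j) * a j * pairing Omega (phi j) f)) //.
apply/funext => N; apply: eq_bigr => j _.
rewrite (pairingC f) (pairingC _ g); ring.
Qed.

Lemma ae_diagonal0 : \forall x \ae mu, Omega x -> T (fun=> 0) x = 0.
Proof.
have Z := L2_0 mO finO.
apply: (L2_sum_unique mO finO phi_L2 (T_sum Z)); split => //.
rewrite (_ : (fun N => _) = fun=> 0%E); first exact: cvg_cst.
apply/funext => N; apply: integral0_eq => x _.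
rewrite big1 ?subrr ?expr0n// => j _; rewrite /pairing.
under eq_Rintegral do rewrite mul0r.
by rewrite Rintegral_cst// !mul0r.
Qed.

Lemma L2_L1w f : L2 Omega f -> L1w Omega w f.
Proof.
move=> [mf fi]; split => //.
have i1 := rintZ mO W (rintD mO (rint_cst mO finO 1) fi).
apply: (ae_le_rint mO _ i1); first exact: measurable_funM.
apply: aeW => x Ox; rewrite normrM (gtr0_norm (w_gt0 Ox)) mulrC.
rewrite ler_pM ?(ltW (w_gt0 Ox)) ?w_le// -real_normK ?num_real//.
by move: `|f x| (normr_ge0 (f x)) => b b0; nra.
Qed.

(** Continuity at 0 together with [ae_diagonal0]. This replaces an operator norm, which would
    require linearity. *)
Lemma diagonal_bounded : exists2 d, 0 < d & forall f, L1w Omega w f ->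
  L1w_rnorm Omega w f < d -> L1w_rnorm Omega w (T f) < 1.
Proof.
have Zw : L1w Omega w (fun=> 0) := L2_L1w (L2_0 mO finO).
have [d d0 Hd] := T_cont.2 _ Zw _ ltr01; exists d => // f fw fd.
have := Hd f fw.
rewrite (_ : (f \- _)%R = f); last by apply/funext => x /=; rewrite subr0.
rewrite (L1w_normE mO)// lte_fin => /(_ fd).
have Tf := T_cont.1 _ fw; have T0 := T_cont.1 _ Zw.
rewrite (L1w_normE mO); last exact: (L1wB mO).
rewrite lte_fin; congr (_ < _); apply: ae_eq_Rintegral => //.
- apply: measurableT_comp => //; apply: measurable_funM => //.
  by apply: measurable_funB; [exact: Tf.1|exact: T0.1].
- by apply: measurableT_comp => //; apply: measurable_funM => //; exact: Tf.1.
by apply: filterS ae_diagonal0 => x hx Ox /=; rewrite hx// subr0.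
Qed.

(* Duality with the boundedness of [T] on L^1(w):
   [T psi] is tested against its own truncation to [{|T psi| > N w}]. *)
Lemma wLinfty_diagonal psi : wLinfty Omega w psi -> wLinfty Omega w (T psi).
Proof.
move=> wpsi; have /(wLinftyP mw w_gt0)[mpsi [M M0 HM]] := wpsi.
have psiL : L2 Omega psi.
  by apply: Linfty_L2 => //; apply: (wLinfty_Linfty _ _ w_le).
set h := T psi; have hL : L2 Omega h := (T_sum psiL).1; have [mh hi] := hL.
apply/(wLinftyP mw w_gt0); split => //.
have [d d0 Hd] := diagonal_bounded.
(* Chosen so that a multiple of the truncation with norm d/2 pairs with T psi to at least (d/2) N =
   M + 1, whereas symmetry bounds the pairing by M. *)
pose N := 2 * (M + 1) / d.
have N0 : 0 < N by rewrite divr_gt0// mulr_gt0// ltr_wpDl.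
exists N; first exact: ltW.
pose e x := if N * w x < `|h x| then h x else 0.
have me : measurable_fun Omega e.
  apply: measurable_fun_if => //.
    apply: measurable_fun_ltr; first exact: measurable_funM.
    exact: measurableT_comp.
  by apply: measurable_funS mh => // x [].
have eL : L2 Omega e.
  split => //; apply: (ae_le_rint mO _ hi); first exact: measurable_funX.
  apply: aeW => x _; rewrite /e; case: ifP => _; rewrite normrX ?normr0 ?expr0n/= ?sqr_ge0//.
  by rewrite real_normK ?num_real.
have ew := L2_L1w eL; have [_ ewi] := ew.
pose I := L1w_rnorm Omega w e.
have I0 : 0 <= I by apply: Rintegral_ge0.
(* If I = 0 the truncation [e] vanishes a.e., which is the desired bound; otherwise it can be
   rescaled into the ball of [diagonal_bounded]. *)
have [I_eq0|I_neq0] := eqVneq I 0.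
  have : (\int[mu]_(x in Omega) `|(e x * w x)%:E| = 0)%E.
    rewrite -[LHS]fineK; last exact/integrable_fin_num/rint_norm.
    by rewrite -[RHS]/(0%:E) -I_eq0.
  move=> /(ae_eq_integral_abs _ mO) E.
  have {}E : ae_eq mu Omega (fun x => (e x * w x)%:E) (cst 0%E).
    by apply: E; exact: measurable_int ewi.
  apply: filterS E => x /[swap] Ox /(_ Ox) [] /eqP.
  rewrite mulf_eq0 (gt_eqF (w_gt0 Ox)) orbF /e; case: ltP => // + /eqP hx.
  by rewrite hx normr0 => /lt_geF; rewrite mulr_ge0 ?(ltW N0) ?(ltW (w_gt0 Ox)).
have {I_neq0}I_gt0 : 0 < I by rewrite lt_neqAle eq_sym I_neq0.
pose c := d / 2 / I; have c0 : 0 < c by rewrite divr_gt0// divr_gt0.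
pose ce x := c * e x.
have ceL : L2 Omega ce by exact: L2Z.
have ceI : L1w_rnorm Omega w ce = d / 2.
  rewrite /L1w_rnorm /ce; under eq_Rintegral do rewrite -mulrA normrM (gtr0_norm c0).
  rewrite RintegralZl//; last exact: rint_norm.
  by rewrite -/(L1w_rnorm Omega w e) -/I /c divfK ?gt_eqF.
have /ltW Tce : L1w_rnorm Omega w (T ce) < 1.
  by apply: Hd; [exact: L2_L1w|rewrite ceI; lra].
have Tcew : L1w Omega w (T ce) by exact/T_cont.1/L2_L1w.
have := pairing_le_rnorm mO mw w_gt0 Tcew mpsi M0 HM.
rewrite -/(pairing Omega (T ce) psi) diagonal_symmetric_L2// -/h => up.
(* Where [e] is non-zero, e h = h^2 >= N w |h|. *)
have lo : c * N * I <= pairing Omega ce h.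
  rewrite /I /L1w_rnorm -RintegralZl//; last exact: rint_norm.
  have iN : ri (fun x => c * N * `|e x * w x|) by apply: rintZ => //; exact: rint_norm.
  apply: ae_le_Rintegral => //; first exact: L2_mul_rint.
  have cN0 : 0 <= c * N by rewrite ltW// mulr_gt0.
  apply: aeW => x Ox; rewrite (mulr_ge0 cN0 (normr_ge0 _))/=.
  have -> : ce x * h x = c * (e x * h x) by rewrite /ce mulrA.
  rewrite -mulrA; apply: ler_wpM2l; first exact: ltW.
  rewrite normrM (gtr0_norm (w_gt0 Ox)) /e.
  case: ltP => [lt|_]; last by rewrite normr0 !mul0r mulr0.
  rewrite -expr2 -[leRHS]real_normK ?num_real// expr2 mulrCA mulrA [_ * w x]mulrC.
  by rewrite mulrCA ler_wpM2l// mulrC ltW.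
suff : M + 1 <= M by rewrite gerDl ler10.
have cNI : c * N * I = M + 1 by rewrite /c /N; field; rewrite !gt_eqF.
rewrite -cNI (le_trans lo)// (le_trans (ler_norm _))// (le_trans up)//.
by rewrite ler_piMr.
Qed.

Lemma diagonal_symmetric f psi : L1w Omega w f -> wLinfty Omega w psi ->
  \int[mu]_(x in Omega) (T f x * psi x) = \int[mu]_(x in Omega) (f x * T psi x).
Proof.
move=> fw wpsi; have wT := wLinfty_diagonal wpsi.
have /(wLinftyP mw w_gt0)[mpsi [M M0 HM]] := wpsi.
have /(wLinftyP mw w_gt0)[mT [N N0 HN]] := wT.
have psiL : L2 Omega psi.
  by apply: Linfty_L2 => //; apply: (wLinfty_Linfty _ _ w_le).
apply/eqP; rewrite -subr_eq0 -normr_le0; apply/ler_addgt0Pr => e e0; rewrite add0r.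
(* [M] and [N] bound psi and T psi relative to w; the two errors below cost N e' and M e'. *)
pose e' := e / (M + N + 1).
have MN0 : 0 < M + N + 1 by rewrite ltr_wpDl// addr_ge0.
have e'0 : 0 < e' by rewrite divr_gt0.
have [d d0 Hd] := T_cont.2 _ fw _ e'0.
have d'0 : 0 < Num.min d e' by rewrite lt_min d0.
have [g [gLi]] := Linfty_dense mO finO mw w_gt0 w_le fw d'0.
rewrite lt_min => /andP[gd ge'].
have gw := Linfty_L1w mO finO mw w_gt0 w_le gLi.
have gL := Linfty_L2 mO finO gLi.
have Tfw := T_cont.1 _ fw; have Tgw := T_cont.1 _ gw.
have := Hd _ gw; rewrite (L1w_normE mO); last exact: (L1wB mO).
rewrite lte_fin => /(_ gd); rewrite (L1w_normE mO); last exact: (L1wB mO).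
rewrite lte_fin => Te'.
(* The identity already known for the bounded function g is inserted, leaving only terms in g - f
   and T g - T f. *)
have E : \int[mu]_(x in Omega) (T f x * psi x) - \int[mu]_(x in Omega) (f x * T psi x) =
  \int[mu]_(x in Omega) ((g x - f x) * T psi x) -
  \int[mu]_(x in Omega) ((T g x - T f x) * psi x).
  under [in RHS]eq_Rintegral do rewrite mulrBl.
  under [X in _ = _ - X]eq_Rintegral do rewrite mulrBl.
  rewrite !RintegralB//; try exact: (L1w_wLinfty_rint mO mw w_gt0).
  have := diagonal_symmetric_L2 gL psiL; rewrite /pairing => ->; ring.
rewrite E (le_trans (ler_normB _ _))//.
have b1 := pairing_le_rnorm mO mw w_gt0 (L1wB mO gw fw) mT N0 HN.
have b2 := pairing_le_rnorm mO mw w_gt0 (L1wB mO Tgw Tfw) mpsi M0 HM.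
apply: (@le_trans _ _ (N * e' + M * e')).
  rewrite lerD//; [rewrite (le_trans b1)//|rewrite (le_trans b2)//];
    by rewrite ler_wpM2l// ltW.
by rewrite -mulrDl /e' mulrCA ler_piMr ?(ltW e0)// ler_pdivrMr// mul1r; lra.
Qed.

End diagonal_operator.

(** ** The Green kernel *)

Section test_functions.
Context {R : realType} {n : nat}.
Variables (Omega : set 'rV[R]_n) (gamma : R).
Local Notation mu := (@lebesgue_rV R n).
Local Notation w := (dist_pow Omega gamma).
Hypothesis oO : open Omega.
Hypothesis gamma_gt0 : 0 < gamma.
Hypothesis w_gt0 : forall x, Omega x -> 0 < w x.
Implicit Types f h psi : 'rV[R]_n -> R.

Let mO : measurable Omega := open_measurable_rV oO.

Lemma measurable_dist_pow : measurable_fun setT w.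
Proof.
apply: (measurableT_comp (measurable_powR _)); apply: continuous_measurable_rV.
exact: continuous_dist_bdry.
Qed.

Let mw : measurable_fun Omega w := measurable_funTS measurable_dist_pow.

Lemma dist_pow_compact_ge (K : set 'rV[R]_n) : compact K -> K `<=` Omega ->
  exists2 c, 0 < c & forall x, K x -> c <= w x.
Proof.
move=> cK KO; have [->|/set0P K0] := eqVneq K set0; first by exists 1.
have [|k /set_mem Kk kmin] := @compact_EVT_min _ _ (dist_bdry Omega) _ K0 cK.
  by apply: continuous_subspaceT; exact: continuous_dist_bdry.
exists (w k); first exact/w_gt0/KO.
move=> x Kx; apply: ge0_ler_powR; rewrite ?nnegrE ?dist_bdry_ge0 ?(ltW gamma_gt0)//.
by apply: kmin; exact/mem_set.
Qed.

Lemma Linfty_c_wLinfty psi : Linfty_c Omega psi -> wLinfty Omega w psi.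
Proof.
move=> [[mpsi [M HM]] [K [cK KO HK]]].
have [c c0 cw] := dist_pow_compact_ge cK KO.
apply/(wLinftyP mw w_gt0); split => //; exists (`|M| / c).
  by rewrite divr_ge0// ltW.
apply: filterS2 HM HK => x HM HK Ox; have [Kx|nKx] := pselect (K x).
  rewrite (le_trans (HM Ox))// (le_trans (ler_norm _))// mulrAC ler_pdivlMr//.
  by rewrite ler_wpM2l// cw.
by rewrite HK// normr0 mulr_ge0 ?divr_ge0 ?(ltW c0)// ltW// w_gt0.
Qed.

Lemma Cinfty_c_Linfty_c psi : Cinfty_c Omega psi -> Linfty_c Omega psi.
Proof.
move=> [spsi [K [cK KO HK]]].
have cpsi : continuous psi.
  by move=> x; apply: differentiable_continuous; exact: (spsi [::]).
have mpsi : measurable_fun Omega psi.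
  by apply: measurable_funTS; exact: continuous_measurable_rV.
split; last by exists K; split => //; apply: aeW => x _; exact: HK.
split => //.
have /compact_bounded[M [_ /(_ (`|M| + 1))]] : compact (psi @` K).
  by apply: continuous_compact => //; exact: continuous_subspaceT.
rewrite (le_lt_trans (ler_norm _)) ?ltrDl// => /(_ isT) HM.
exists (`|M| + 1); apply: aeW => x _; have [Kx|nKx] := pselect (K x).
  by apply: HM; exists x.
by rewrite HK// normr0 addr_ge0.
Qed.

Lemma Cinfty_c_wLinfty psi : Cinfty_c Omega psi -> wLinfty Omega w psi.
Proof. by move=> /Cinfty_c_Linfty_c/Linfty_c_wLinfty. Qed.

(** On a compact box w >= c > 0, so |h| <= |h w|/c there and h has the local integrability that the
    fundamental lemma asks for. *)
Lemma L1w_ae_eq0 h : L1w Omega w h ->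
  (forall psi, Cinfty_c Omega psi -> \int[mu]_(x in Omega) (h x * psi x) = 0) ->
  \forall x \ae mu, Omega x -> h x = 0.
Proof.
move=> [mh hi] h0; apply: Cinfty_c_ae_eq0 => // a b abO.
have abO' : obox a b `<=` Omega by exact: subset_trans (@obox_sub_cbox _ _ a b) abO.
have mab := measurable_obox a b.
have [c c0 cw] := dist_pow_compact_ge (@compact_cbox _ _ a b) abO.
have hi' : rint mu (obox a b) (fun x => c^-1 * `|h x * w x|).
  apply: (rintZ mab); by apply: rint_norm; exact: integrableS hi.
apply: (ae_le_rint mab _ hi'); first exact: measurable_funS mh.
apply: aeW => x abx; rewrite ler_pdivlMl// normrM mulrC ler_wpM2l//.
rewrite (le_trans (cw x _)) ?ler_norm//; exact: obox_sub_cbox.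
Qed.

End test_functions.

(** * The Green kernel extended by zero and its weighted bound *)

Section green_kernel.
Context {R : realType} {n : nat}.
Variables (Omega : set 'rV[R]_n) (s gamma : R) (G : 'rV[R]_n -> 'rV[R]_n -> R).
Local Notation mu := (@lebesgue_rV R n).
Local Notation w := (dist_pow Omega gamma).
Hypothesis n_ge1 : (1 <= n)%N.
Hypothesis s_gt0 : 0 < s.
Hypothesis oO : open Omega.
Hypothesis bO : bounded_set Omega.
Hypothesis GK1 : K1 Omega s gamma G.

Let mO : measurable Omega := open_measurable_rV oO.
Let gamma_gt0 : 0 < gamma.
Proof. by have /andP[] := K1_gamma GK1. Qed.

Lemma open_not_singleton x : Omega x -> exists2 y, Omega y & x <> y.
Proof.
move=> Ox; have /nbhs_ballP[e /= e0 xe] : nbhs x Omega by exact: open_nbhs_nbhs.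
exists (x + const_mx (e / 2)).
  apply: xe; split => // i j; rewrite !mxE /ball/= opprD addrA subrr sub0r normrN.
  by rewrite gtr0_norm ?divr_gt0//; lra.
move=> /rowP/(_ (Ordinal n_ge1)); rewrite !mxE => /eqP.
by rewrite -subr_eq0 opprD addrA subrr sub0r oppr_eq0 gt_eqF// divr_gt0.
Qed.

(* The two-sided bound forces [delta > 0] since [G > 0]. *)
Lemma dist_pow_gt0 x : Omega x -> 0 < w x.
Proof.
move=> Ox; have [y Oy xy] := open_not_singleton Ox.
rewrite lt_neqAle powR_ge0 andbT eq_sym; apply/negP => /eqP wx0.
have [C C0 /(_ x y Ox Oy xy) /andP[_]] := K1_bounds GK1.
rewrite /green_profile wx0 !mul0r minElt ltr01 !mulr0.
by rewrite leNgt (K1_pos GK1).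
Qed.

Lemma dist_pow_le : exists W, forall x, Omega x -> w x <= W.
Proof.
have [->|/set0P[x0 Ox0]] := eqVneq Omega set0; first by exists 0.
have [D D0 HD] := bounded_enorm bO.
exists ((dist_bdry Omega x0 + (D + D)) `^ gamma) => x Ox.
apply: ge0_ler_powR; rewrite ?nnegrE ?dist_bdry_ge0 ?(ltW gamma_gt0)//.
  by rewrite addr_ge0 ?dist_bdry_ge0// addr_ge0// ltW.
rewrite (le_trans (dist_bdry_lipschitz _ _ x0))// lerD2l.
rewrite (le_trans (enorm_triangle x 0 x0))// lerD//; first by rewrite subr0 HD.
by rewrite (enormC 0) subr0 HD.
Qed.

Lemma dist_pow_lipschitz x y : w x <= w y + enorm (x - y) `^ gamma.
Proof.
rewrite (le_trans _ (powR_subadditive (dist_bdry_ge0 _ _) (enorm_ge0 _) (K1_gamma GK1)))//.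
by apply: ge0_ler_powR; rewrite ?nnegrE ?addr_ge0 ?dist_bdry_ge0 ?enorm_ge0
  ?(ltW gamma_gt0)//; exact: dist_bdry_lipschitz.
Qed.

(** Used with a = w(y), b = w(x), r = |x - y|^gamma. If r <= b then a <= 2b; otherwise a <= 2r and
    a^2/r^2 <= 4. *)
Lemma mul_min_le (a b r : R) : 0 < a -> 0 < b -> 0 < r -> a <= b + r ->
  Num.min (b * a / r ^+ 2) 1 * a <= 4 * b.
Proof.
move=> a0 b0 r0 abr; have [rb|br] := leP r b.
  rewrite (@le_trans _ _ (1 * a))// ?ler_pM2r// ?ge_min ?lexx ?orbT//; lra.
rewrite (@le_trans _ _ (b * a / r ^+ 2 * a))// ?ler_pM2r// ?ge_min ?lexx//.
rewrite mulrAC ler_pdivrMr ?exprn_gt0// -!mulrA [4 * _]mulrCA ler_pM2l//.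
have : a <= 2 * r by lra.
move=> h; have : a * a <= (2 * r) * (2 * r) by rewrite ler_pM// ltW.
by rewrite expr2; lra.
Qed.

(** [G] is unconstrained on the diagonal and outside [Omega]; setting it to 0 there yields a kernel
    that is measurable, non-negative and symmetric on the whole space. *)
Definition green_kernel (x y : 'rV[R]_n) : R :=
  ((fun z => G z.1 z.2) \_
   [set z : 'rV[R]_n * 'rV[R]_n | [/\ Omega z.1, Omega z.2 & z.1 <> z.2]]) (x, y).

Lemma green_kernelE x y : Omega x -> Omega y -> x <> y -> green_kernel x y = G x y.
Proof. by move=> Ox Oy xy; rewrite /green_kernel patchE mem_set. Qed.

Lemma green_kernel_out x y : ~ [/\ Omega x, Omega y & x <> y] -> green_kernel x y = 0.
Proof. by move=> h; rewrite /green_kernel patchE memNset. Qed.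

Lemma measurable_green_kernel :
  measurable_fun setT (fun z : 'rV[R]_n * 'rV[R]_n => green_kernel z.1 z.2).
Proof.
rewrite (_ : (fun z => _) = (fun z => G z.1 z.2) \_
   [set z : 'rV[R]_n * 'rV[R]_n | [/\ Omega z.1, Omega z.2 & z.1 <> z.2]]); last first.
  by apply/funext => -[x y].
set D := [set _ | _].
suff mD : measurable D by apply/(measurable_restrictT _ mD); exact: (K1_measurable GK1).
rewrite (_ : D = (Omega `*` Omega) `&`
    [set z : 'rV[R]_n * 'rV[R]_n | z.1 <> z.2]).
  by apply: measurableI; [exact: measurableX|exact: measurable_neq_rV].
by apply/seteqP; split => z [] // [].
Qed.

Lemma green_kernel_ge0 x y : 0 <= green_kernel x y.
Proof.
have [[Ox Oy xy]|h] := pselect [/\ Omega x, Omega y & x <> y].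
  by rewrite green_kernelE// ltW// (K1_pos GK1).
by rewrite green_kernel_out.
Qed.

Lemma green_kernel_sym x y : green_kernel x y = green_kernel y x.
Proof.
have [[Ox Oy xy]|h] := pselect [/\ Omega x, Omega y & x <> y].
  by rewrite !green_kernelE//; [exact: (K1_sym GK1)|exact/nesym].
by rewrite !green_kernel_out// => -[Oy Ox xy]; apply: h; split => //; exact/nesym.
Qed.

Lemma green_kernel_weight : exists2 C, 0 <= C & forall x, Omega x ->
  (\int[mu]_(y in Omega) (green_kernel x y * w y)%:E <= (C * w x)%:E)%E.
Proof.
have [C C0 HC] := K1_bounds GK1.
have [K K0 HK] := riesz_potential_bounded n_ge1 s_gt0 mO bO (K1_dim GK1).
have mwO : measurable_fun Omega w := measurable_funTS (measurable_dist_pow Omega gamma).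
(* From G(x,y) w(y) <= 4 C w(x) |x - y|^(2s-n): 4 is from [mul_min_le], C from the upper Green
   bound, K from the Riesz potential. *)
exists (4 * C * K); first by rewrite !mulr_ge0// ltW.
move=> x Ox; pose N y := enorm (y - x) `^ (- (n%:R - 2 * s)).
have N0 y : 0 <= N y by exact: powR_ge0.
have mN : measurable_fun Omega N.
  apply: (measurableT_comp (measurable_powR _)); apply: measurable_funTS.
  apply: (measurableT_comp measurable_enorm).
  apply: measurable_fun_rVP => i; under eq_fun do rewrite !mxE.
  by apply: measurable_funB => //; exact: measurable_coord.
apply: (@le_trans _ _ (\int[mu]_(y in Omega) ((4 * C * w x)%:E * (N y)%:E))%E).
  apply: ge0_le_integral => //.
  - by move=> y Oy; rewrite lee_fin mulr_ge0 ?green_kernel_ge0// powR_ge0.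
  - apply/measurable_EFinP; apply: measurable_funM => //; apply: measurable_funTS.
    exact: (measurableT_comp measurable_green_kernel (pair1_measurable x)).
  - by apply/measurable_EFinP; apply: measurable_funM.
  move=> y Oy; rewrite -EFinM lee_fin; have [xy|xy] := eqVneq x y.
    rewrite green_kernel_out ?mul0r ?mulr_ge0 ?(ltW C0) ?powR_ge0//.
    by move=> -[_ _].
  have {}xy : x <> y by exact/eqP.
  rewrite green_kernelE//; have /andP[_ up] := HC _ _ Ox Oy xy.
  rewrite (le_trans (ler_wpM2r (powR_ge0 _ _) up))//.
  rewrite /green_profile [2 * gamma]mulrC powRrM powR_mulrn ?powR_ge0//.
  rewrite -/(w y) -(enormC y x) -/(N y).
  set r := enorm (y - x) `^ gamma.
  have r0 : 0 < r by rewrite powR_gt0// enorm_gt0 subr_eq0 eq_sym; exact/eqP.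
  have := mul_min_le (dist_pow_gt0 Oy) (dist_pow_gt0 Ox) r0 (dist_pow_lipschitz y x).
  move=> /(ler_wpM2l (N0 y))/(ler_wpM2l (ltW C0)).
  by congr (_ <= _); ring.
rewrite ge0_integralZl_EFin//.
- rewrite (_ : 4 * C * K * w x = 4 * C * w x * K); last by ring.
  by rewrite [leRHS]EFinM lee_wpmul2l ?HK// lee_fin !mulr_ge0 ?powR_ge0// ltW.
- by move=> y _; rewrite lee_fin.
- exact/measurable_EFinP.
- by rewrite !mulr_ge0 ?powR_ge0// ltW.
Qed.

Lemma green_opE f x : measurable_fun Omega f -> Omega x ->
  green_op Omega G f x = kernel_op Omega green_kernel f x.
Proof.
move=> mf Ox; apply/esym.
have mK : measurable_fun Omega (fun y => green_kernel x y * f y).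
  apply: measurable_funM => //; apply: measurable_funTS.
  exact: (measurableT_comp measurable_green_kernel (pair1_measurable x)).
apply: (ae_eq_Rintegral mO mK).
  (* (K1) gives measurability off the diagonal only; the single value at y = x is added back through
     the indicator of {x}. *)
  apply: (eq_measurable_fun (fun y => green_kernel x y * f y + G x x * f x * \1_[set x] y)).
    move=> y /set_mem Oy; rewrite indicE; have [->|yx] := eqVneq y x.
      by rewrite mem_set// mulr1 green_kernel_out ?mul0r ?add0r// => -[].
    rewrite memNset; last exact/eqP.
    by rewrite mulr0 addr0 green_kernelE//; apply/eqP; rewrite eq_sym.
  apply: measurable_funD => //; apply: measurable_funM => //.
  by apply: measurable_indic; exact: measurable_set1_rV.
exists [set x]; split; [exact: measurable_set1_rV|exact: lebesgue_rV_set1|].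
move=> y /= ny; apply: contrapT => yx; apply: ny => Oy.
by rewrite green_kernelE//; exact/nesym.
Qed.

End green_kernel.

(** ** Equivalence of the formulations *)

Section resolvent_equivalences.
Context {R : realType} {n : nat}.
Variables (Omega : set 'rV[R]_n) (w : 'rV[R]_n -> R) (W C lambda : R).
Variable K : 'rV[R]_n -> 'rV[R]_n -> R.
Variables (lam : nat -> R) (phi : nat -> 'rV[R]_n -> R).
Variable T : ('rV[R]_n -> R) -> 'rV[R]_n -> R.
Local Notation mu := (@lebesgue_rV R n).
Local Notation ri := (rint mu Omega).
Local Notation A := (kernel_op Omega K).
Hypothesis mO : measurable Omega.
Hypothesis finO : (mu Omega < +oo)%E.
Hypothesis mw : measurable_fun Omega w.
Hypothesis w_gt0 : forall x, Omega x -> 0 < w x.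
Hypothesis w_le : forall x, Omega x -> w x <= W.
Hypothesis mK : measurable_fun setT (fun z : 'rV[R]_n * 'rV[R]_n => K z.1 z.2).
Hypothesis K_ge0 : forall x y, 0 <= K x y.
Hypothesis K_sym : forall x y, K x y = K y x.
Hypothesis C_ge0 : 0 <= C.
Hypothesis K_le : forall x, Omega x ->
  (\int[mu]_(y in Omega) (K x y * w y)%:E <= (C * w x)%:E)%E.
Hypothesis lam_neq0 : forall j, lam j != 0.
Hypothesis lam_neq : forall j, lam j - lambda != 0.
Hypothesis phi_onb : orthonormal_basis Omega phi.
Hypothesis phi_w : forall j, wLinfty Omega w (phi j).
Hypothesis phi_eig : forall j, \forall x \ae mu, Omega x -> phi j x = lam j * A (phi j) x.
Hypothesis T_cont : L1w_continuous Omega w T.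
Hypothesis T_sum : forall f, L2 Omega f ->
  L2_sum Omega (fun j => pairing Omega f (phi j) / (lam j - lambda)) phi (T f).
Implicit Types f u psi : 'rV[R]_n -> R.

Let phi_L2 j : L2 Omega (phi j). Proof. by have [] := phi_onb. Qed.

Let wL1w psi : wLinfty Omega w psi -> L1w Omega w psi.
Proof.
move=> h; apply: (Linfty_L1w mO finO mw w_gt0 w_le).
exact: (wLinfty_Linfty mw w_gt0 w_le h).
Qed.

Let wL2 psi : wLinfty Omega w psi -> L2 Omega psi.
Proof. by move=> h; apply: Linfty_L2 => //; exact: (wLinfty_Linfty mw w_gt0 w_le h). Qed.

Let Aw psi : wLinfty Omega w psi -> wLinfty Omega w (A psi).
Proof. exact: (wLinfty_kernel_op mO mw w_gt0 mK K_ge0 C_ge0 K_le). Qed.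

Let Tw psi : wLinfty Omega w psi -> wLinfty Omega w (T psi).
Proof. exact: (wLinfty_diagonal mO finO mw w_gt0 w_le phi_L2 T_cont T_sum). Qed.

Lemma L2_sum_coef c g j : L2_sum Omega c phi g -> pairing Omega g (phi j) = c j.
Proof.
move=> gS; have H := L2_sum_pairing mO finO phi_L2 gS (phi_L2 j).
apply: (cvg_unique (@norm_hausdorff _ _) H).
(* By orthonormality the partial sums are constant as soon as they contain the index j. *)
apply: cvg_near_cst; exists j.+1 => // N /= jN.
have [_ on _] := phi_onb.
rewrite (bigD1 (Ordinal jN))//= on eqxx mulr1 big1 ?addr0// => i ij.
by rewrite on (_ : (_ == _) = false) ?mulr0//; apply/negbTE.
Qed.

Lemma ae_kernel_op_phi j :
  \forall x \ae mu, Omega x -> A (phi j) x = (lam j)^-1 * phi j x.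
Proof. by apply: filterS (phi_eig j) => x h Ox; rewrite h// mulKf. Qed.

Lemma pairing_kernel_op psi j : wLinfty Omega w psi ->
  pairing Omega (A psi) (phi j) = (lam j)^-1 * pairing Omega psi (phi j).
Proof.
move=> wpsi; rewrite /pairing.
rewrite (kernel_op_symmetric mO mw w_gt0 mK K_ge0 K_sym C_ge0 K_le)//; last exact: wL1w.
have i1 := L1w_wLinfty_rint mO mw w_gt0 (wL1w wpsi) (phi_w j).
rewrite -RintegralZl//; apply: ae_eq_Rintegral => //.
- exact: (rint_measurable (L1w_wLinfty_rint mO mw w_gt0 (wL1w wpsi) (Aw (phi_w j)))).
- exact: (rint_measurable (rintZ mO _ i1)).
by apply: filterS (ae_kernel_op_phi j) => x h Ox; rewrite h// mulrCA.
Qed.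

Let pairing_lin a f g j : L2 Omega f -> L2 Omega g ->
  pairing Omega (fun x => f x + a * g x) (phi j) =
  pairing Omega f (phi j) + a * pairing Omega g (phi j).
Proof.
move=> fL gL; rewrite /pairing; under eq_Rintegral do rewrite mulrDl -mulrA.
have i1 := L2_mul_rint mO fL (phi_L2 j); have i2 := L2_mul_rint mO gL (phi_L2 j).
by rewrite RintegralD// ?RintegralZl//; exact: rintZ.
Qed.

(** With c_j the coefficients of psi, both sides have coefficients (1 - lambda/lam_j) c_j/(lam_j -
    lambda) = c_j/lam_j. *)
Lemma ae_T_sub_kernel_op psi : wLinfty Omega w psi -> \forall x \ae mu, Omega x ->
  T (fun x => psi x - lambda * A psi x) x = A psi x.
Proof.
move=> wpsi; have wApsi := Aw wpsi.
have wchi := wLinftyB mw w_gt0 wpsi (wLinftyZ mw w_gt0 lambda wApsi).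
have [_ _ basis] := phi_onb.
apply: (L2_sum_unique mO finO phi_L2 (T_sum (wL2 wchi))).
rewrite (_ : (fun j => _) = fun j => pairing Omega (A psi) (phi j)).
  exact/basis/wL2.
apply/funext => j.
rewrite (_ : (fun x => _) = fun x => psi x + - lambda * A psi x); last first.
  by apply/funext => x; rewrite mulNr.
rewrite pairing_lin ?pairing_kernel_op//; [|exact: wL2|exact: wL2].
by field; rewrite lam_neq lam_neq0.
Qed.

(** Both sides have coefficients (c_j + lambda c_j/(lam_j - lambda))/lam_j = c_j/(lam_j -
    lambda). *)
Lemma ae_kernel_op_add_T psi : wLinfty Omega w psi -> \forall x \ae mu, Omega x ->
  A (fun x => psi x + lambda * T psi x) x = T psi x.
Proof.
move=> wpsi; have wTpsi := Tw wpsi.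
have wchi := wLinftyD mw w_gt0 wpsi (wLinftyZ mw w_gt0 lambda wTpsi).
have [_ _ basis] := phi_onb.
apply: (L2_sum_unique mO finO phi_L2 (basis _ (wL2 (Aw wchi)))).
rewrite (_ : (fun j => _) = fun j => pairing Omega psi (phi j) / (lam j - lambda)).
  exact/T_sum/wL2.
apply/funext => j; rewrite pairing_kernel_op// pairing_lin; [|exact: wL2|exact: wL2].
rewrite (L2_sum_coef j (T_sum (wL2 wpsi))).
by field; rewrite lam_neq lam_neq0.
Qed.

(** * Implications between the formulations, for fixed data *)

Variables (f u : 'rV[R]_n -> R).
Hypothesis fw : L1w Omega w f.
Hypothesis uw : L1w Omega w u.

Let ae_eq_pairing h psi psi' : L1w Omega w h -> wLinfty Omega w psi ->
  wLinfty Omega w psi' -> (\forall x \ae mu, Omega x -> psi x = psi' x) ->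
  \int[mu]_(x in Omega) (h x * psi x) = \int[mu]_(x in Omega) (h x * psi' x).
Proof.
move=> hw wpsi wpsi' E; apply: ae_eq_Rintegral => //.
- exact: (rint_measurable (L1w_wLinfty_rint mO mw w_gt0 hw wpsi)).
- exact: (rint_measurable (L1w_wLinfty_rint mO mw w_gt0 hw wpsi')).
by apply: filterS E => x Ex Ox; rewrite Ex.
Qed.

Let T_sym psi : wLinfty Omega w psi ->
  \int[mu]_(x in Omega) (T f x * psi x) = \int[mu]_(x in Omega) (f x * T psi x).
Proof. exact: (diagonal_symmetric mO finO mw w_gt0 w_le phi_L2 T_cont T_sum fw). Qed.

Let A_sym h psi : L1w Omega w h -> wLinfty Omega w psi ->
  \int[mu]_(x in Omega) (A h x * psi x) = \int[mu]_(x in Omega) (h x * A psi x).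
Proof. exact: (kernel_op_symmetric mO mw w_gt0 mK K_ge0 K_sym C_ge0 K_le). Qed.

Lemma resolvent_dual : (\forall x \ae mu, Omega x -> u x = T f x) ->
  forall psi, wLinfty Omega w psi ->
  \int[mu]_(x in Omega) (u x * psi x) = \int[mu]_(x in Omega) (f x * T psi x).
Proof.
move=> E psi wpsi; rewrite -T_sym//; have Tfw := T_cont.1 _ fw.
apply: ae_eq_Rintegral => //.
- exact: (rint_measurable (L1w_wLinfty_rint mO mw w_gt0 uw wpsi)).
- exact: (rint_measurable (L1w_wLinfty_rint mO mw w_gt0 Tfw wpsi)).
by apply: filterS E => x Ex Ox; rewrite Ex.
Qed.

Lemma dual_weak_dual : (forall psi, wLinfty Omega w psi ->
    \int[mu]_(x in Omega) (u x * psi x) = \int[mu]_(x in Omega) (f x * T psi x)) ->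
  forall psi, wLinfty Omega w psi ->
  \int[mu]_(x in Omega) (u x * (psi x - lambda * A psi x)) =
  \int[mu]_(x in Omega) (f x * A psi x).
Proof.
move=> D psi wpsi; have wApsi := Aw wpsi.
have wchi := wLinftyB mw w_gt0 wpsi (wLinftyZ mw w_gt0 lambda wApsi).
rewrite (D _ wchi); apply: ae_eq_pairing => //; first exact: Tw.
exact: ae_T_sub_kernel_op.
Qed.

(** Symmetry of [A] moves it onto psi; the residual of the Green equation, tested by psi, is thus
    the defect of the weak formulation. Both directions between the two rest on this. *)
Let pairing_residual psi : wLinfty Omega w psi ->
  \int[mu]_(x in Omega) ((u x - (lambda * A u x + A f x)) * psi x) =
  \int[mu]_(x in Omega) (u x * (psi x - lambda * A psi x)) -
  \int[mu]_(x in Omega) (f x * A psi x).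
Proof.
move=> wpsi; have wApsi := Aw wpsi.
have Afw : L1w Omega w (A f) by exact: (L1w_kernel_op mO mw w_gt0 mK K_ge0 K_sym C_ge0 K_le).
have Auw : L1w Omega w (A u) by exact: (L1w_kernel_op mO mw w_gt0 mK K_ge0 K_sym C_ge0 K_le).
have i h p : L1w Omega w h -> wLinfty Omega w p -> ri (fun x => h x * p x).
  exact: (L1w_wLinfty_rint mO mw w_gt0).
have iu := i _ _ uw wpsi; have iAu := i _ _ Auw wpsi; have iAf := i _ _ Afw wpsi.
have iuA := i _ _ uw wApsi.
transitivity (\int[mu]_(x in Omega) (u x * psi x) -
  (lambda * \int[mu]_(x in Omega) (A u x * psi x) + \int[mu]_(x in Omega) (A f x * psi x))).
  under eq_Rintegral do rewrite mulrBl mulrDl -mulrA.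
  rewrite RintegralB//; last by apply: rintD => //; exact: rintZ.
  by rewrite RintegralD ?RintegralZl//; exact: rintZ.
rewrite !A_sym// opprD addrA; congr (_ - _).
under [in RHS]eq_Rintegral do rewrite mulrBr mulrCA.
by rewrite RintegralB ?RintegralZl//; exact: rintZ.
Qed.

(** The weight is abstract here, so the two facts tied to the distance function, the fundamental
    lemma and the inclusion of test functions in w L^oo, are taken as premises. *)
Lemma weak_dual_green : (forall h, L1w Omega w h ->
    (forall psi, Cinfty_c Omega psi -> \int[mu]_(x in Omega) (h x * psi x) = 0) ->
    \forall x \ae mu, Omega x -> h x = 0) ->
  (forall psi, Cinfty_c Omega psi -> wLinfty Omega w psi) ->
  (forall psi, Cinfty_c Omega psi ->
    \int[mu]_(x in Omega) (u x * (psi x - lambda * A psi x)) =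
    \int[mu]_(x in Omega) (f x * A psi x)) ->
  \forall x \ae mu, Omega x -> u x = lambda * A u x + A f x.
Proof.
move=> fund Cw D.
have hw : L1w Omega w (fun x => u x - (lambda * A u x + A f x)).
  apply: (L1wB mO) => //; apply: (L1wD mO) => //; last first.
    exact: (L1w_kernel_op mO mw w_gt0 mK K_ge0 K_sym C_ge0 K_le).
  by apply: (L1wZ mO); exact: (L1w_kernel_op mO mw w_gt0 mK K_ge0 K_sym C_ge0 K_le).
have h0 psi : Cinfty_c Omega psi ->
    \int[mu]_(x in Omega) ((u x - (lambda * A u x + A f x)) * psi x) = 0.
  by move=> psiC; rewrite pairing_residual ?D ?subrr//; exact: Cw.
by apply: filterS (fund _ hw h0) => x h Ox; apply/eqP; rewrite -subr_eq0 h.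
Qed.

Lemma green_weak_dual :
  (\forall x \ae mu, Omega x -> u x = lambda * A u x + A f x) ->
  forall psi, wLinfty Omega w psi ->
  \int[mu]_(x in Omega) (u x * (psi x - lambda * A psi x)) =
  \int[mu]_(x in Omega) (f x * A psi x).
Proof.
move=> E psi wpsi; apply/eqP; rewrite -subr_eq0 -pairing_residual//.
have hw : L1w Omega w (fun x => u x - (lambda * A u x + A f x)).
  apply: (L1wB mO) => //; apply: (L1wD mO) => //; last first.
    exact: (L1w_kernel_op mO mw w_gt0 mK K_ge0 K_sym C_ge0 K_le).
  by apply: (L1wZ mO); exact: (L1w_kernel_op mO mw w_gt0 mK K_ge0 K_sym C_ge0 K_le).
have -> : 0 = \int[mu]_(x in Omega) (0 : R) by rewrite Rintegral_cst// mul0r.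
apply/eqP; apply: ae_eq_Rintegral => //.
  exact: (rint_measurable (L1w_wLinfty_rint mO mw w_gt0 hw wpsi)).
by apply: filterS E => x Ex Ox; rewrite {1}Ex// subrr mul0r.
Qed.

Lemma green_resolvent : (forall h, L1w Omega w h ->
    (forall psi, Cinfty_c Omega psi -> \int[mu]_(x in Omega) (h x * psi x) = 0) ->
    \forall x \ae mu, Omega x -> h x = 0) ->
  (forall psi, Cinfty_c Omega psi -> wLinfty Omega w psi) ->
  (\forall x \ae mu, Omega x -> u x = lambda * A u x + A f x) ->
  \forall x \ae mu, Omega x -> u x = T f x.
Proof.
move=> fund Cw E; have Tfw := T_cont.1 _ fw.
have h0 psi : Cinfty_c Omega psi ->
    \int[mu]_(x in Omega) ((u x - T f x) * psi x) = 0.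
  move=> /Cw wpsi; have wTpsi := Tw wpsi.
  (* The function chi = psi + lambda T psi satisfies A chi = T psi, hence chi - lambda A chi = psi
     a.e.: the weak formulation tested by chi is exactly the duality for psi. *)
  have wchi := wLinftyD mw w_gt0 wpsi (wLinftyZ mw w_gt0 lambda wTpsi).
  have wAchi := Aw wchi.
  have wd := wLinftyB mw w_gt0 wchi (wLinftyZ mw w_gt0 lambda wAchi).
  under eq_Rintegral do rewrite mulrBl.
  rewrite RintegralB//; [|exact: (L1w_wLinfty_rint mO mw w_gt0)..].
  rewrite T_sym//.
  have ETA := ae_kernel_op_add_T wpsi.
  rewrite -(ae_eq_pairing fw wAchi wTpsi ETA) -(green_weak_dual E wchi).
  apply/eqP; rewrite subr_eq0; apply/eqP; apply: ae_eq_pairing => //.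
  by apply: filterS ETA => x h Ox; rewrite h// addrK.
by apply: filterS (fund _ (L1wB mO uw Tfw) h0) => x h Ox; apply/eqP; rewrite -subr_eq0 h.
Qed.

(** The eigenfunction phi_j is itself an admissible test function; as A phi_j = phi_j/lam_j, the
    weak formulation becomes the claim divided by lam_j. *)
Lemma green_coefficients :
  (\forall x \ae mu, Omega x -> u x = lambda * A u x + A f x) ->
  forall j, (lam j - lambda) * \int[mu]_(x in Omega) (u x * phi j x) =
    \int[mu]_(x in Omega) (f x * phi j x).
Proof.
move=> E j; have := green_weak_dual E (phi_w j); have Ej := ae_kernel_op_phi j.
have wZ a := wLinftyZ mw w_gt0 a (phi_w j); have wA := Aw (phi_w j).
have wd := wLinftyB mw w_gt0 (phi_w j) (wLinftyZ mw w_gt0 lambda wA).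
have iu := L1w_wLinfty_rint mO mw w_gt0 uw (phi_w j).
have jf := L1w_wLinfty_rint mO mw w_gt0 fw (phi_w j).
rewrite (ae_eq_pairing uw wd (wZ (1 - lambda / lam j))); last first.
  by apply: filterS Ej => x h Ox; rewrite h//; ring.
rewrite (ae_eq_pairing fw wA (wZ (lam j)^-1))//.
under eq_Rintegral do rewrite mulrCA.
under [in X in _ = X -> _]eq_Rintegral do rewrite mulrCA.
rewrite !RintegralZl// => H.
apply: (mulfI (invr_neq0 (lam_neq0 j))); rewrite -H mulrA; congr (_ * _).
by rewrite mulrBr mulVf// mulrC.
Qed.

(** In L^2 a function is determined by its coefficients, and those of u are the ones defining T
    f. *)
Lemma coefficients_resolvent : L2 Omega f -> L2 Omega u ->
  (forall j, (lam j - lambda) * \int[mu]_(x in Omega) (u x * phi j x) =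
    \int[mu]_(x in Omega) (f x * phi j x)) ->
  \forall x \ae mu, Omega x -> u x = T f x.
Proof.
move=> fL uL E; have [_ _ basis] := phi_onb.
apply: (L2_sum_unique mO finO phi_L2 (basis _ uL)).
rewrite (_ : (fun j => _) = fun j => pairing Omega f (phi j) / (lam j - lambda)).
  exact: T_sum.
by apply/funext => j; rewrite /pairing -E mulrC mulKf.
Qed.

End resolvent_equivalences.

Theorem theorem2p1 (R : realType) (n : nat) (s gamma lambda : R)
  (Omega : set 'rV[R]_n) (G : 'rV[R]_n -> 'rV[R]_n -> R)
  (lam : nat -> R) (phi : nat -> 'rV[R]_n -> R)
  (Glambda : ('rV[R]_n -> R) -> ('rV[R]_n -> R)) (f u : 'rV[R]_n -> R)
  (n_ge1 : (1 <= n)%N) (s01 : 0 < s < 1)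
  (Omega_C11 : bounded_C11_open Omega)
  (G_K1 : K1 Omega s gamma G)
  (lam_phi : eigenbasis Omega gamma G lam phi)
  (lambda_notin_Sigma : ~ range lam lambda)
  (Glambda_resolvent : is_resolvent Omega gamma lam phi lambda Glambda)
  (f_L1w : L1w Omega (dist_pow Omega gamma) f)
  (u_L1w : L1w Omega (dist_pow Omega gamma) u) :
  let mu := @lebesgue_rV R n in
  let G0 := green_op Omega G in
  let c1 := \forall x \ae mu, Omega x -> u x = Glambda f x in
  let c2 := forall psi, wLinfty Omega (dist_pow Omega gamma) psi ->
    \int[mu]_(x in Omega) (u x * psi x) =
    \int[mu]_(x in Omega) (f x * Glambda psi x) in
  let c3 := forall psi, Linfty_c Omega psi ->
    \int[mu]_(x in Omega) (u x * (psi x - lambda * G0 psi x)) =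
    \int[mu]_(x in Omega) (f x * G0 psi x) in
  let c4 := forall psi, Cinfty_c Omega psi ->
    \int[mu]_(x in Omega) (u x * (psi x - lambda * G0 psi x)) =
    \int[mu]_(x in Omega) (f x * G0 psi x) in
  let c5 := \forall x \ae mu, Omega x -> u x = lambda * G0 u x + G0 f x in
  let c6 := forall j, (lam j - lambda) * \int[mu]_(x in Omega) (u x * phi j x) =
    \int[mu]_(x in Omega) (f x * phi j x) in
  [<-> c1; c2; c3; c4; c5] /\
  (L2 Omega f -> H2L Omega lam phi u -> [<-> c1; c2; c3; c4; c5; c6]).
Proof.
move=> mu G0 c1 c2 c3 c4 c5 c6.
have [oO bO _] := Omega_C11; have /andP[s_gt0 _] := s01.
have mO := open_measurable_rV oO.
have finO := measurable_bounded_lebesgue_rV mO bO.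
have /andP[gamma_gt0 _] := K1_gamma G_K1.
have w_gt0 := dist_pow_gt0 n_ge1 oO G_K1.
have [W w_le] := dist_pow_le bO G_K1.
have mw : measurable_fun Omega (dist_pow Omega gamma).
  by apply: measurable_funTS; exact: measurable_dist_pow.
pose K := green_kernel Omega G.
have mK := measurable_green_kernel oO G_K1.
have K_ge0 := green_kernel_ge0 G_K1; have K_sym := green_kernel_sym G_K1.
have [C C_ge0 K_le] := green_kernel_weight n_ge1 s_gt0 oO bO G_K1.
have lam_gt0 j : 0 < lam j.
  rewrite (lt_le_trans (lam_gt0 lam_phi))//.
  exact: (lam_nondecreasing lam_phi).
have lam_neq0 j : lam j != 0 by rewrite gt_eqF.
have lam_neq j : lam j - lambda != 0.
  by rewrite subr_eq0; apply/eqP => E; apply: lambda_notin_Sigma; exists j.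
have phi_onb := phi_basis lam_phi.
have phi_w := phi_wLinfty lam_phi.
have G0E (psi : 'rV[R]_n -> R) x : measurable_fun Omega psi -> Omega x ->
    G0 psi x = kernel_op Omega K psi x.
  exact: (green_opE n_ge1 oO G_K1).
have phi_eig j : \forall x \ae mu, Omega x -> phi j x = lam j * kernel_op Omega K (phi j) x.
  apply: filterS (phi_eigen lam_phi j) => x E Ox; rewrite E// -/(G0 _ _) G0E//.
  by have [] := phi_w j.
have [T_cont T_sum] := Glambda_resolvent.
have fund := L1w_ae_eq0 oO gamma_gt0 w_gt0.
have Lw := Linfty_c_wLinfty gamma_gt0 w_gt0.
have Cw := Cinfty_c_wLinfty gamma_gt0 w_gt0.
(* The original Green operator and the one with the extended kernel agree at every point of [Omega],
   so the integrals can be exchanged pointwise. *)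
have dualE (psi : 'rV[R]_n -> R) : measurable_fun Omega psi ->
    (\int[mu]_(x in Omega) (u x * (psi x - lambda * G0 psi x)) =
     \int[mu]_(x in Omega) (f x * G0 psi x)) <->
    (\int[mu]_(x in Omega) (u x * (psi x - lambda * kernel_op Omega K psi x)) =
     \int[mu]_(x in Omega) (f x * kernel_op Omega K psi x)).
  move=> mpsi.
  have -> : \int[mu]_(x in Omega) (u x * (psi x - lambda * G0 psi x)) =
      \int[mu]_(x in Omega) (u x * (psi x - lambda * kernel_op Omega K psi x)).
    by apply: eq_Rintegral => x /set_mem Ox; rewrite G0E.
  have -> // : \int[mu]_(x in Omega) (f x * G0 psi x) =
      \int[mu]_(x in Omega) (f x * kernel_op Omega K psi x).
  by apply: eq_Rintegral => x /set_mem Ox; rewrite G0E.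
have c5E : c5 <-> \forall x \ae mu, Omega x ->
    u x = lambda * kernel_op Omega K u x + kernel_op Omega K f x.
  have [mu_ _] := u_L1w; have [mf _] := f_L1w.
  by split; apply: filterS => x E Ox; rewrite E// !G0E.
have c12 : c1 -> c2.
  exact: (resolvent_dual mO finO mw w_gt0 w_le phi_onb T_cont T_sum f_L1w u_L1w).
have c23 : c2 -> c3.
  move=> H psi psic; apply: (dualE psi psic.1.1).2.
  apply: (dual_weak_dual mO finO mw w_gt0 w_le mK K_ge0 K_sym C_ge0 K_le lam_neq0
    lam_neq phi_onb phi_w phi_eig T_cont T_sum f_L1w H).
  exact: Lw.
have c34 : c3 -> c4 by move=> H psi /Cinfty_c_Linfty_c; exact: H.
have c45 : c4 -> c5.
  move=> H; apply/c5E; apply: (weak_dual_green mO mw w_gt0 mK K_ge0 K_sym C_ge0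
    K_le f_L1w u_L1w fund Cw) => psi psic.
  exact: (dualE psi (Cw _ psic).1).1 (H psi psic).
have c51 : c5 -> c1.
  move=> /c5E; exact: (green_resolvent mO finO mw w_gt0 w_le mK K_ge0 K_sym C_ge0 K_le
    lam_neq0 lam_neq phi_onb phi_w phi_eig T_cont T_sum f_L1w u_L1w fund Cw).
split; first by tfae.
(* In the longer cycle [c6] sits between [c5] and [c1]; only the two implications through it
   remain. *)
move=> fL [uL _]; tfae => //.
- move=> /c5E; exact: (green_coefficients mO mw w_gt0 mK K_ge0 K_sym C_ge0 K_le
    lam_neq0 phi_w phi_eig f_L1w u_L1w).
- exact: (coefficients_resolvent mO finO lam_neq phi_onb T_sum fL uL).
Qed.
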